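(* Let $H$ be a separable real Hilbert space and let $A$ be a strictly positive unbounded (self-adjoint) linear operator on $H$, with inverse $A^{-1}$ not necessarily compact. Let $\mu:(0,\infty)\to[0,\infty)$, $\mu\not\equiv 0$, be nonincreasing, locally absolutely continuous and summable on $(0,\infty)$, and assume that for some $\delta>0$ $$\mu'(s)+\delta\mu(s)\le 0\quad\text{for all (almost every) } s\in(0,\infty).$$ Let $S(t)=e^{t\mathbb{A}}$ be the contraction semigroup, with infinitesimal generator $\mathbb{A}$, associated (as described in the context) with the linear equation with memory $$\partial_{tt}u(t)+Au(t)+\int_0^\infty \mu(s)[u(t)-u(t-s)]\,ds=0.$$ Assume that there exist $p\in[0,1)$ and $\ell>0$ such that $$\lim_{s\to 0^+}s^p\mu(s)=\ell.$$ Then $$\limsup_{\lambda\to\infty}\lambda^{p-2}\,\|(i\lambda-\mathbb{A})^{-1}\|>0.$$ Accordingly, $\|S(t)\mathbb{A}^{-1}\|$ cannot decay faster than $t^{-\frac{1}{2-p}}$ as $t\to\infty$, that is, $$\limsup_{t\to\infty}t^{\frac1{2-p}}\,\|S(t)\mathbb{A}^{-1}\|>0.$$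
   Context: ''Strictly positive'' means $A$ is self-adjoint with $\langle Au,u\rangle_H\ge c\|u\|_H^2$ for some $c>0$ and all $u\in D(A)$. ''Locally absolutely continuous on $(0,\infty)$'' means absolutely continuous on every compact subinterval of $(0,\infty)$. Semigroup. Let $s_\infty=\sup\{s>0:\mu(s)>0\}\in(0,\infty]$ and let $\mathcal{M}=L^2_\mu((0,s_\infty);H)$ be the Hilbert space of $H$-valued functions $\eta$ on $(0,s_\infty)$ with inner product $\langle\eta,\xi\rangle_{\mathcal M}=\int_0^{s_\infty}\mu(s)\langle\eta(s),\xi(s)\rangle_H\,ds$. The memory variable is $\eta^t(s)=u(t)-u(t-s)$. The phase space is $\mathcal{H}=D(A^{1/2})\times H\times\mathcal{M}$ with norm $\|(u,v,\eta)\|^2=\|A^{1/2}u\|_H^2+\|v\|_H^2+\|\eta\|_{\mathcal M}^2$. The equation is rewritten as the abstract evolution equation $\frac{d}{dt}z=\mathbb{A}z$ for $z=(u,\partial_t u,\eta)$, where $$\mathbb{A}(u,v,\eta)=\Big(v,\,-Au-\int_0^{s_\infty}\mu(s)\eta(s)\,ds,\,-\eta'+v\Big),$$ with $\eta'$ the weak derivative in $s$, and domain $$D(\mathbb{A})=\{(u,v,\eta)\in\mathcal{H}:\ u\in D(A),\ v\in D(A^{1/2}),\ \eta'\in\mathcal{M},\ \lim_{s\to0^+}\eta(s)=0\text{ in }H\}.$$ It is known that $\mathbb{A}$ generates a contraction semigroup $S(t)=e^{t\mathbb{A}}$ on $\mathcal{H}$, and that under the hypotheses of the claim the imaginary axis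 $i\mathbb{R}$ is contained in the resolvent set of (the complexification of) $\mathbb{A}$, so the operators $(i\lambda-\mathbb{A})^{-1}$, $\lambda\in\mathbb{R}$, and $\mathbb{A}^{-1}$ are bounded. The resolvent is understood on the complexification of $\mathcal{H}$, and norms are operator norms. *)

(* Defs.v *)
From HB Require Import structures.
From mathcomp Require Import all_boot all_order all_algebra.
From mathcomp Require Import generic_quotient ring.
From mathcomp Require Import all_classical all_reals all_analysis.
From mathcomp Require Import measurable_realfun complex.

Set Implicit Arguments.
Unset Strict Implicit.
Unset Printing Implicit Defensive.

Import Order.TTheory GRing.Theory Num.Theory.
Import numFieldNormedType.Exports.

Local Open Scope classical_set_scope.
Local Open Scope ring_scope.

HB.mixin Record NormedModule_isHilbert (R : realType) H
    & CompleteNormedModule R H := {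
  dot : H -> H -> R;
  dotC : forall x y, dot x y = dot y x;
  dotDl : forall x y z, dot (x + y) z = dot x z + dot y z;
  dotZl : forall a x y, dot (a *: x) y = a * dot x y;
  dot_norm : forall x, dot x x = `|x| ^+ 2 }.

(* Real Hilbert spaces: complete, with the norm induced by the inner product. *)
#[short(type="hilbertType")]
HB.structure Definition Hilbert (R : realType) :=
  {H of NormedModule_isHilbert R H & CompleteNormedModule R H}.

Definition separable (T : topologicalType) :=
  exists2 D : set T, countable D & dense D.

(* A linear operator defined on the subspace [dom]; the values of [apply]     *)
(* outside [dom] are irrelevant.                                              *)
Record operator (R : realType) (V : lmodType R) := Operator {
  dom : set V;
  apply :> V -> V;
  dom0 : dom 0;
  dom_linear : forall a x y, dom x -> dom y -> dom (a *: x + y);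
  apply_linear : forall a x y, dom x -> dom y ->
    apply (a *: x + y) = a *: apply x + apply y }.

Section OperatorDomain.
Context (R : realType) (V : lmodType R) (T : operator V).

Definition dom_pred : {pred V} := fun x => `[< dom T x >].

Lemma dom_submod_closed : submod_closed dom_pred.
Proof.
split; first by apply/asboolP; exact: dom0.
by move=> a x y /asboolP xT /asboolP yT; apply/asboolP; exact: dom_linear.
Qed.

HB.instance Definition _ := GRing.isSubmodClosed.Build R V dom_pred
  dom_submod_closed.

Record dom_type := DomType { dom_val : V; _ : dom_val \in dom_pred }.

HB.instance Definition _ := [isSub for dom_val].
HB.instance Definition _ := [Choice of dom_type by <:].
HB.instance Definition _ := [SubChoice_isSubLmodule of dom_type by <:].

End OperatorDomain.

Section OperatorsOnHilbertSpaces.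
Context (R : realType) (H : hilbertType R).
Implicit Types A B : operator H.

(* The right-hand side says that (y, z) is in the graph of the adjoint of A.  *)
Definition self_adjoint A :=
  dense (dom A) /\
  forall y z, (dom A y /\ A y = z) <->
              (forall x, dom A x -> dot (A x) y = dot x z).

Definition strictly_positive A :=
  self_adjoint A /\
  exists2 c : R, 0 < c & forall u, dom A u -> c * `|u| ^+ 2 <= dot (A u) u.

Definition unbounded A :=
  ~ exists C : R, forall u, dom A u -> `|A u| <= C * `|u|.

(* B = A^{1/2}: B is the nonnegative self-adjoint operator with B^2 = A, the  *)
(* domain of B^2 being {x in dom B | B x in dom B}.                           *)
Definition is_sqrt A B :=
  [/\ self_adjoint B,
      forall u, dom B u -> 0 <= dot (B u) u,
      forall u, dom A u <-> dom B u /\ dom B (B u) &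
      forall u, dom A u -> B (B u) = A u].

End OperatorsOnHilbertSpaces.

Section AbsoluteContinuity.
Context (R : realType).
Implicit Types (f : R -> R) (a b : R).

Definition abs_continuous a b f :=
  forall e : R, 0 < e -> exists2 d : R, 0 < d &
  forall (n : nat) (l r : 'I_n -> R),
    (forall i, [/\ a <= l i, l i <= r i & r i <= b]) ->
    (forall i j, i != j -> r i <= l j \/ r j <= l i) ->
    \sum_(i < n) (r i - l i) < d ->
    \sum_(i < n) `|f (r i) - f (l i)| < e.

Definition locally_abs_continuous f :=
  forall a b, 0 < a -> a <= b -> abs_continuous a b f.

End AbsoluteContinuity.

(* Only the values of a kernel on (0, +oo) matter. *)
Record memory_kernel (R : realType) := MemoryKernel {
  kernel :> R -> R;
  kernel_ge0 : forall s, 0 < s -> 0 <= kernel s;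
  kernel_neq0 : exists2 s, 0 < s & kernel s != 0;
  kernel_nonincreasing :
    forall s t, 0 < s -> s <= t -> kernel t <= kernel s;
  kernel_abs_continuous : locally_abs_continuous kernel;
  kernel_summable :
    (@lebesgue_measure R).-integrable `]0, +oo[ (EFin \o kernel) }.

Section HistoryInterval.
Context (R : realType) (mu : memory_kernel R).

Definition s_infty : \bar R :=
  ereal_sup [set s%:E | s in [set s | 0 < s /\ 0 < mu s]].

Definition history : set R := [set s | 0 < s /\ (s%:E < s_infty)%E].

Lemma measurable_history : measurable history.
Proof.
apply: is_interval_measurable => x y [x0 _] [_ ys] z /andP[xz zy].
split; first exact: lt_le_trans xz.
by apply: le_lt_trans ys; rewrite lee_fin.
Qed.

Lemma history_sub : history `<=` `]0, +oo[.
Proof. by move=> s []; rewrite /= in_itv /= => ->. Qed.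

Lemma kernel_measurable : measurable_fun history mu.
Proof.
apply: (measurable_funS _ history_sub) => //.
by apply/measurable_EFinP; exact: measurable_int (kernel_summable mu).
Qed.

End HistoryInterval.

Section VectorValuedFunctions.
Context (R : realType) (H : hilbertType R).
Implicit Types (f g : R -> H) (D : set R) (w : H).

Definition simple f :=
  finite_set (range f) /\ forall h, measurable (f @^-1` [set h]).

(* Strong (Bochner) measurability. *)
Definition strongly_measurable f :=
  exists2 s : (R -> H)^nat, forall n, simple (s n) &
    forall x, s n x @[n --> \oo] --> f x.

(* w is the integral of f over D, in the sense of Pettis. *)
Definition is_integral D f w := forall h,
  (@lebesgue_measure R).-integrable D (fun s => (dot (f s) h)%:E) /\
  \int[@lebesgue_measure R]_(s in D) dot (f s) h = dot w h.

Lemma simple_cst h : simple (cst h).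
Proof.
split; first by apply: (sub_finite_set _ (finite_set1 h)) => _ [x _ <-].
move=> k; have [->|hk] := eqVneq h k.
  by rewrite (_ : _ @^-1` _ = setT) //; apply/seteqP; split.
rewrite (_ : _ @^-1` _ = set0) //; apply/seteqP; split=> // x /= /eqP.
by rewrite (negbTE hk).
Qed.

Lemma simple_lincomb a f g : simple f -> simple g -> simple (a *: f + g).
Proof.
move=> [ff mf] [fg mg]; split.
  have := finite_image2 (fun x y => a *: x + y) ff fg.
  by apply: sub_finite_set => _ [x _ <-]; exists (f x) => //; exists (g x).
move=> h; have -> : (a *: f + g) @^-1` [set h] =
    \bigcup_(k in range f) (f @^-1` [set k] `&` g @^-1` [set h - a *: k]).
  apply/seteqP; split=> x /=.
    move=> <-; exists (f x); first by exists x.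
    split=> //=; have -> : (a *: f + g) x = a *: f x + g x by [].
    by rewrite addrAC subrr add0r.
  move=> [k _ [/= <- E]]; have -> : (a *: f + g) x = a *: f x + g x by [].
  by rewrite E addrC subrK.
by apply: fin_bigcup_measurable => // k _; apply: measurableI.
Qed.

Lemma strongly_measurable_cst h : strongly_measurable (cst h).
Proof.
exists (fun=> cst h); first by move=> _; exact: simple_cst.
by move=> x; exact: cvg_cst.
Qed.

Lemma strongly_measurable_lincomb a f g :
  strongly_measurable f -> strongly_measurable g ->
  strongly_measurable (a *: f + g).
Proof.
move=> [s ss sf] [t st tg]; exists (fun n => a *: s n + t n).
  by move=> n; exact: simple_lincomb.
by move=> x; apply: cvgD (tg x); apply: cvgZr; exact: sf.
Qed.

Lemma simple_norm_measurable f : simple f ->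
  measurable_fun setT (fun x => `|f x| : R).
Proof.
move=> [ff mf] _ Y mY; rewrite setTI.
have -> : (fun x => `|f x|) @^-1` Y =
    \bigcup_(k in range f `&` [set k | Y `|k|]) f @^-1` [set k].
  apply/seteqP; split=> x /=.
    by move=> Yx; exists (f x) => //; split=> //; exists x.
  by move=> [k [_ /= Yk] /= ->].
by apply: fin_bigcup_measurable => //; exact: finite_setIl.
Qed.

Lemma strongly_measurable_norm f : strongly_measurable f ->
  measurable_fun setT (fun x => `|f x| : R).
Proof.
move=> [s ss sf].
apply: (measurable_fun_cvg (h := fun n x => `|s n x| : R)).
- by move=> n; exact: simple_norm_measurable.
- by move=> x _; apply: cvg_norm; exact: sf.
Qed.

End VectorValuedFunctions.

Section MemorySpace.
Context (R : realType) (H : hilbertType R) (mu : memory_kernel R).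
Local Notation leb := (@lebesgue_measure R).
Local Notation I := (history mu).

Definition L2_pred : {pred R -> H} := fun f =>
  `[< strongly_measurable f /\
      leb.-integrable I (fun s => (mu s * `|f s| ^+ 2)%:E) >].

Lemma weight_measurable (f : R -> H) : strongly_measurable f ->
  measurable_fun I (fun s => mu s * `|f s| ^+ 2).
Proof.
move=> mf; apply: measurable_funM; first exact: kernel_measurable.
apply: measurable_funX; apply: measurable_funTS.
exact: strongly_measurable_norm.
Qed.

Lemma L2_submod_closed : submod_closed L2_pred.
Proof.
split.
  apply/asboolP; split; first exact: strongly_measurable_cst.
  rewrite (_ : (fun _ => _) = cst 0%E); first exact: integrable0.
  by apply/funext => s /=; rewrite normr0 expr0n mulr0.
move=> a f g /asboolP[mf intf] /asboolP[mg intg]; apply/asboolP.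
have mfg := strongly_measurable_lincomb a mf mg; split => //.
have mI : measurable I := @measurable_history R mu.
pose F s := ((2 * `|a| ^+ 2)%:E * (mu s * `|f s| ^+ 2)%:E
             + 2%:E * (mu s * `|g s| ^+ 2)%:E)%E.
apply: (@le_integrable _ _ _ leb _ mI _ F).
- by apply/measurable_EFinP; exact: weight_measurable.
- move=> s [s0 _]; rewrite /F -!EFinM -EFinD !abse_EFin lee_fin.
  have mu0 := kernel_ge0 mu s0.
  have : `|(a *: f + g) s| <= `|a| * `|f s| + `|g s|.
    by rewrite (le_trans (ler_normD _ _)) // normrZ.
  move: `|a| `|f s| `|g s| `|(a *: f + g) s| (mu s) mu0
    (normr_ge0 a) (normr_ge0 (f s)) (normr_ge0 (g s))
    (normr_ge0 ((a *: f + g) s)) => x y z w m m0 x0 y0 z0 w0 le_w.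
  rewrite !ger0_norm ?addr_ge0 ?mulr_ge0 ?sqr_ge0 //.
  have -> : 2 * x ^+ 2 * (m * y ^+ 2) + 2 * (m * z ^+ 2) =
            m * ((x * y + z) ^+ 2 + (x * y - z) ^+ 2) by ring.
  apply: ler_wpM2l => //; apply: (@le_trans _ _ ((x * y + z) ^+ 2)).
    by rewrite lerXn2r // nnegrE addr_ge0 ?mulr_ge0.
  by rewrite lerDl sqr_ge0.
- by apply: integrableD => //; apply: integrableZl.
Qed.

HB.instance Definition _ := GRing.isSubmodClosed.Build R (R -> H) L2_pred
  L2_submod_closed.

Record L2_fun := L2Fun { L2_val :> R -> H; _ : L2_val \in L2_pred }.

HB.instance Definition _ := [isSub for L2_val].
HB.instance Definition _ := [Choice of L2_fun by <:].
HB.instance Definition _ := [SubChoice_isSubLmodule of L2_fun by <:].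

Definition L2_eq (f g : L2_fun) := `[< ae_eq leb I f g >].

Lemma L2_eq_refl : reflexive L2_eq.
Proof. by move=> f; apply/asboolP; exact: ae_eq_refl. Qed.

Lemma L2_eq_sym : symmetric L2_eq.
Proof. by move=> f g; apply/asboolP/asboolP; exact: ae_eq_sym. Qed.

Lemma L2_eq_trans : transitive L2_eq.
Proof.
by move=> g f h /asboolP fg /asboolP gh; apply/asboolP; exact: ae_eq_trans gh.
Qed.

Canonical L2_equiv := EquivRel L2_eq L2_eq_refl L2_eq_sym L2_eq_trans.

Local Open Scope quotient_scope.

(* M = L^2_mu((0, s_infty); H): square-integrable functions modulo equality   *)
(* almost everywhere on (0, s_infty).                                         *)
Definition memory_space : Type := {eq_quot L2_eq}.
HB.instance Definition _ := Choice.on memory_space.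
HB.instance Definition _ := EqQuotient.on memory_space.

Local Notation M := memory_space.

Lemma memory_space_eqP (f g : L2_fun) :
  \pi_M f = \pi_M g <-> ae_eq leb I f g.
Proof. by split=> [/eqmodP/asboolP //|fg]; apply/eqmodP/asboolP. Qed.

Lemma ae_eq_repr (f : L2_fun) : ae_eq leb I (repr (\pi_M f) : L2_fun) f.
Proof. by apply/memory_space_eqP; rewrite reprK. Qed.

Definition memory_add (x y : M) : M := \pi_M (repr x + repr y).
Definition memory_opp (x : M) : M := \pi_M (- repr x).
Definition memory_scale (a : R) (x : M) : M := \pi_M (a *: repr x).

Lemma memory_addE f g : memory_add (\pi f) (\pi g) = \pi_M (f + g).
Proof.
apply/memory_space_eqP.
have := ae_eq_repr g; have := ae_eq_repr f; apply: filterS2 => s E1 E2 sI.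
by rewrite /= !fctE E1 ?E2.
Qed.

Lemma memory_oppE f : memory_opp (\pi f) = \pi_M (- f).
Proof.
apply/memory_space_eqP; have := ae_eq_repr f; apply: filterS => s E sI.
by rewrite /= !fctE E.
Qed.

Lemma memory_scaleE a f : memory_scale a (\pi f) = \pi_M (a *: f).
Proof.
apply/memory_space_eqP; have := ae_eq_repr f; apply: filterS => s E sI.
by rewrite /= !fctE E.
Qed.

Lemma memory_addA : associative memory_add.
Proof.
by elim/quotW=> f; elim/quotW=> g; elim/quotW=> h; rewrite !memory_addE addrA.
Qed.

Lemma memory_addC : commutative memory_add.
Proof. by elim/quotW=> f; elim/quotW=> g; rewrite !memory_addE addrC. Qed.

Lemma memory_add0 : left_id (\pi_M 0) memory_add.
Proof. by elim/quotW=> f; rewrite memory_addE add0r. Qed.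

Lemma memory_addN : left_inverse (\pi_M 0) memory_opp memory_add.
Proof. by elim/quotW=> f; rewrite memory_oppE memory_addE addNr. Qed.

HB.instance Definition _ := GRing.isZmodule.Build M
  memory_addA memory_addC memory_add0 memory_addN.

Lemma memory_scaleA a b x :
  memory_scale a (memory_scale b x) = memory_scale (a * b) x.
Proof. by elim/quotW: x => f; rewrite !memory_scaleE scalerA. Qed.

Lemma memory_scale1 : left_id 1 memory_scale.
Proof. by elim/quotW=> f; rewrite memory_scaleE scale1r. Qed.

Lemma memory_scaleDr : right_distributive memory_scale +%R.
Proof.
move=> a; elim/quotW=> f; elim/quotW=> g; rewrite /GRing.add /=.
by rewrite !(memory_addE, memory_scaleE) scalerDr.
Qed.

Lemma memory_scaleDl x : {morph memory_scale^~ x : a b / a + b}.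
Proof.
move=> a b; elim/quotW: x => f; rewrite [in RHS]/GRing.add /=.
by rewrite !(memory_addE, memory_scaleE) scalerDl.
Qed.

HB.instance Definition _ := GRing.Zmodule_isLmodule.Build R M
  memory_scaleA memory_scale1 memory_scaleDr memory_scaleDl.

Definition memory_dot (x y : M) : R :=
  \int[leb]_(s in I) (mu s * dot ((repr x : L2_fun) s) ((repr y : L2_fun) s)).

Definition memory_norm (x : M) : R := Num.sqrt (memory_dot x x).

Lemma cst_L2 (v : H) : (cst v : R -> H) \in L2_pred.
Proof.
apply/asboolP; split; first exact: strongly_measurable_cst.
rewrite (_ : (fun _ => _) = (fun s => (`|v| ^+ 2)%:E * (mu s)%:E)%E); last first.
  by apply/funext => s /=; rewrite -EFinM mulrC.
have mI : measurable I := @measurable_history R mu.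
apply: integrableZl => //.
exact: (@integrableS _ _ _ leb `]0, +oo[%classic _ _ (measurable_itv _) mI
  (@history_sub R mu) (kernel_summable mu)).
Qed.

Definition memory_cst (v : H) : M := \pi_M (L2Fun (cst_L2 v)).

(* Scalar test functions of class C^oo with compact support in (0, s_infty).  *)
Definition test_function (phi : R -> R) :=
  (forall n s, derivable (derive1n n phi) s 1) /\
  exists a b, [/\ I a, I b & forall s, ~~ (a <= s <= b) -> phi s = 0].

Definition weak_derivative (x y : M) := forall phi, test_function phi ->
  exists2 w : H,
    is_integral I (fun s => derive1 phi s *: (repr x : L2_fun) s) w &
    is_integral I (fun s => phi s *: (repr y : L2_fun) s) (- w).

(* x tends to 0 at 0+, the value of x being those of its continuous           *)
(* representative.                                                            *)
Definition vanishes_at_0 (x : M) := exists f : L2_fun,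
  [/\ \pi_M f = x, {in I, continuous f} & f s @[s --> 0^'+] --> (0 : H)].

End MemorySpace.

(* Possibly unbounded operators on V, given by their graphs: T x y means that *)
(* x is in the domain of T and T x = y.                                       *)
Definition graph (V : Type) := V -> V -> Prop.

Section Graphs.
Context (R : realType).

Definition graph_inv (V : Type) (T : graph V) : graph V := fun x y => T y x.

(* The operator norm of T with respect to the norm N on V. *)
Definition operator_norm (K : pzRingType) (V : lmodType K) (N : V -> R)
    (T : graph V) : \bar R :=
  ereal_sup [set (N y)%:E | y in [set y | exists2 x, N x <= 1 & T x y]].

(* The graph of z - T. *)
Definition graph_shift (K : pzRingType) (V : lmodType K) (z : K) (T : graph V) :
    graph V :=
  fun x y => exists2 y', T x y' & y = z *: x - y'.

End Graphs.

Section Complexification.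
Context (R : realType) (V : lmodType R).

(* The pair (x, y) stands for x + i y. *)
Definition complexification : Type := (V * V)%type.
HB.instance Definition _ := GRing.Zmodule.on complexification.

Definition complex_scale (z : R[i]) (x : complexification) : complexification :=
  (complex.Re z *: x.1 - complex.Im z *: x.2, complex.Re z *: x.2 + complex.Im z *: x.1).

Lemma complex_scaleA a b x :
  complex_scale a (complex_scale b x) = complex_scale (a * b) x.
Proof.
case: a b x => [a1 a2] [b1 b2] [x y]; rewrite /complex_scale /=; congr pair.
  by rewrite !(scalerDr, scalerDl, scalerN, scaleNr, scalerA, opprD)
    [X in _ + X = _]addrC addrACA.
by rewrite !(scalerDr, scalerDl, scalerN, scaleNr, scalerA)
  [X in _ + X = _]addrC addrACA.
Qed.

Lemma complex_scale1 : left_id 1 complex_scale.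
Proof.
by move=> [x y]; rewrite /complex_scale /= !scale1r !scale0r subr0 addr0.
Qed.

Lemma complex_scaleDr : right_distributive complex_scale +%R.
Proof.
move=> [a1 a2] [x y] [x' y']; rewrite /complex_scale /=; congr pair => /=.
  by rewrite !scalerDr opprD addrACA.
by rewrite !scalerDr addrACA.
Qed.

Lemma complex_scaleDl x : {morph complex_scale^~ x : a b / a + b}.
Proof.
case: x => x y [a1 a2] [b1 b2]; rewrite /complex_scale /=; congr pair => /=.
  by rewrite !scalerDl opprD addrACA.
by rewrite !scalerDl addrACA.
Qed.

HB.instance Definition _ := GRing.Zmodule_isLmodule.Build R[i] complexification
  complex_scaleA complex_scale1 complex_scaleDr complex_scaleDl.

Definition complex_norm (N : V -> R) (x : complexification) : R :=
  Num.sqrt (N x.1 ^+ 2 + N x.2 ^+ 2).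

Definition complex_graph (T : graph V) : graph complexification :=
  fun x y => T x.1 y.1 /\ T x.2 y.2.

(* ||(i la - T)^{-1}||, T being extended to the complexification of V. *)
Definition resolvent_norm (N : V -> R) (T : graph V) (la : R) : \bar R :=
  operator_norm (complex_norm N)
    (graph_inv (graph_shift (Complex 0 la) (complex_graph T))).

End Complexification.

Section Semigroups.
Context (R : realType) (V : lmodType R) (N : V -> R).

Definition contraction_semigroup (S : R -> V -> V) :=
  [/\ forall t, 0 <= t -> linear (S t),
      forall x, S 0 x = x,
      forall s t x, 0 <= s -> 0 <= t -> S (s + t) x = S s (S t x),
      forall t x, 0 <= t -> N (S t x) <= N x &
      forall x, N (S t x - x) @[t --> 0^'+] --> (0 : R)].

Definition generator (S : R -> V -> V) : graph V :=
  fun x y => N (h^-1 *: (S h x - x) - y) @[h --> 0^'+] --> (0 : R).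

(* S is the contraction semigroup e^{tT}. *)
Definition generates (T : graph V) (S : R -> V -> V) :=
  contraction_semigroup S /\ forall x y, generator S x y <-> T x y.

(* ||S(t) T^{-1}|| *)
Definition decay_norm (T : graph V) (S : R -> V -> V) (t : R) : \bar R :=
  operator_norm N (fun x y => exists2 z, graph_inv T x z & y = S t z).

End Semigroups.

Section MemoryEquation.
Context (R : realType) (H : hilbertType R).
Context (A B : operator H) (mu : memory_kernel R).

(* Here B is A^{1/2}. *)
Definition phase_space : Type := (dom_type B * H * memory_space H mu)%type.
HB.instance Definition _ := GRing.Lmodule.on phase_space.

Definition phase_norm (z : phase_space) : R :=
  Num.sqrt (`|B (dom_val z.1.1)| ^+ 2 + `|z.1.2| ^+ 2 + memory_norm z.2 ^+ 2).

Definition memory_generator : graph phase_space :=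
  fun '(u, v, eta) '(u', v', eta') =>
    [/\ dom A (dom_val u),
        (* v is in dom B, and u' = v *)
        dom_val u' = v,
        (exists2 w : H,
          is_integral (history mu)
            (fun s => mu s *: (repr eta : L2_fun H mu) s) w &
          v' = - A (dom_val u) - w),
        (exists2 deta : memory_space H mu,
          weak_derivative eta deta & eta' = - deta + memory_cst mu v) &
        vanishes_at_0 eta].

End MemoryEquation.

(* Main.v *)
(* For w in dom A and la > 0, the function e^{i la t} (w, i la w, (1 - e^{-i la s}) w)
   solves the equation up to the residual A w - la^2 w + w * int mu (1 - e^{-i la s}) ds
   in the velocity component.  As A is unbounded, there are arbitrarily large al with
   approximate eigenvectors A w ~ al w; for la^2 = al + int mu the residual reduces to
   the Fourier transform of mu at la, which is O(la^{p-1}) since mu is nonincreasing and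
   O(s^{-p}) at 0.  The velocity has norm la |w|, so the resolvent at i la has norm at
   least of order la^{2-p}.  Moreover, S(t) z differs from e^{i la t} z by at most t times the
   residual, so S(t) z keeps half of its norm up to a time t of order la^{2-p}, whereas the
   generator multiplies the norm of z by at most 2 la. *)

From HB Require Import structures.
Require Import Defs.
From mathcomp Require Import all_boot all_order all_algebra ssrAC generic_quotient.
From mathcomp Require Import ring lra.
From mathcomp Require Import all_classical all_reals all_analysis.
From mathcomp Require Import measurable_realfun complex.

Set Implicit Arguments.
Unset Strict Implicit.
Unset Printing Implicit Defensive.

Import Order.TTheory GRing.Theory Num.Theory.
Import numFieldNormedType.Exports.
Import HBSimple.

Local Open Scope classical_set_scope.
Local Open Scope ring_scope.

(** * Semi-inner products and complexified seminorms *)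

(** The large approximate eigenvalues are found without the spectral theorem. If there were none
    above some [M], the resolvent of [A] would exist on all of [M, +oo); a Riccati blow-up argument
    then bounds <A u, u> by c |u|^2, and Cauchy-Schwarz for this form makes [A] bounded. The order
    of choices matters: al and hence la come first, and only then w, with relative error la^{p-1},
    so that this error has the same size as the Fourier term. For p > 0 the derivative of mu is not
    integrable at 0, so the Fourier transform cannot be estimated by integrating by parts on the
    whole half-line; a shift by the half period pi / la uses only monotonicity and costs the
    integral of mu over (0, pi / la]. Both conclusions are drawn from the same vectors, the second
    without passing through a resolvent criterion for decay. All is real underneath: a complex state
    is a pair of real ones, on which e^{i a} acts as a rotation. *)

Section SemiInnerProducts.
Context (R : realType) (V : lmodType R).

(** One notion for all the forms that occur: [dot], [memory_dot], [phase_dot], the form <A x, y> on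
    the domain of [A], and their doublings on V * V. *)
Definition semi_inner (b : V -> V -> R) :=
  [/\ forall x y, b x y = b y x,
      forall a x y z, b (a *: x + y) z = a * b x z + b y z &
      forall x, 0 <= b x x].

Definition form_norm (b : V -> V -> R) x := Num.sqrt (b x x).

Variables (b : V -> V -> R) (hb : semi_inner b).
Local Notation N := (form_norm b).

Lemma semi_innerC x y : b x y = b y x. Proof. by case: hb. Qed.

Lemma semi_innerDl x y z : b (x + y) z = b x z + b y z.
Proof. by case: hb => _ h _; have := h 1 x y z; rewrite scale1r mul1r. Qed.

Lemma semi_innerZl a x z : b (a *: x) z = a * b x z.
Proof.
case: hb => _ h _; have := h a x 0 z; rewrite addr0 => ->.
have := h 1 0 0 z; rewrite scale1r addr0 mul1r => e.
have -> : b 0 z = 0 by lra.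
by rewrite addr0.
Qed.

Lemma semi_innerDr x y z : b z (x + y) = b z x + b z y.
Proof. by rewrite ![b z _]semi_innerC semi_innerDl. Qed.

Lemma semi_innerZr a x z : b z (a *: x) = a * b z x.
Proof. by rewrite ![b z _]semi_innerC semi_innerZl. Qed.

Lemma form_norm_ge0 x : 0 <= N x. Proof. exact: sqrtr_ge0. Qed.

Lemma form_norm_sqr x : N x ^+ 2 = b x x.
Proof. by rewrite /form_norm sqr_sqrtr //; case: hb. Qed.

Lemma form_normZ a x : N (a *: x) = `|a| * N x.
Proof.
by rewrite /form_norm semi_innerZl semi_innerZr mulrA -expr2 sqrtrM ?sqr_ge0 // sqrtr_sqr.
Qed.

Lemma semi_inner_CS x y : b x y <= N x * N y.
Proof.
have X0 := form_norm_ge0 x; have Y0 := form_norm_ge0 y.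
have key a : 0 <= a ^+ 2 * N x ^+ 2 - 2 * a * b x y + N y ^+ 2.
  have : 0 <= b ((- a) *: x + y) ((- a) *: x + y) by case: hb.
  rewrite semi_innerDl !semi_innerDr !semi_innerZl !semi_innerZr (semi_innerC y x) -!form_norm_sqr.
  by move=> h; lra.
have [x0|x0] := eqVneq (N x) 0.
  rewrite x0 mul0r leNgt; apply/negP => h.
  (* With N x = 0 the quadratic in a is affine, and this value makes it at most -2 (N y ^+ 2 + 1) +
     N y ^+ 2 < 0. *)
  have := key ((N y ^+ 2 + 1) / b x y); rewrite x0 expr0n /= mulr0 add0r.
  rewrite -mulrA divfK ?gt_eqF //; have := sqr_ge0 (N y).
  by move=> ? ?; lra.
have xp : 0 < N x by rewrite lt_def x0.
have := key (N y / N x); rewrite expr_div_n divfK ?sqrf_eq0 //.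
have e : 2 * (N y / N x) * b x y = 2 * ((N y * b x y) / N x) by field.
rewrite e => h.
have [y0|y0] := eqVneq (N y) 0; last first.
  have yp : 0 < N y by rewrite lt_def y0.
  have : N y * b x y / N x <= N y ^+ 2 by lra.
  by rewrite ler_pdivrMr // expr2 -mulrA ler_pM2l // mulrC.
rewrite y0 mulr0 leNgt; apply/negP => h'.
(* The choice a = N y / N x leaves a factor N y to cancel, so N y = 0 is treated with the minimiser
   of the quadratic instead. *)
have := key (b x y / N x ^+ 2); rewrite y0 expr0n /= addr0 expr_div_n.
have -> : b x y ^+ 2 / (N x ^+ 2) ^+ 2 * N x ^+ 2 -
   2 * (b x y / N x ^+ 2) * b x y = - (b x y / N x) ^+ 2 by field.
by rewrite oppr_ge0 leNgt exprn_gt0 // divr_gt0.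
Qed.

Lemma form_norm_triangle x y : N (x + y) <= N x + N y.
Proof.
rewrite -(@ler_pXn2r _ 2) ?nnegrE ?addr_ge0 ?form_norm_ge0 //.
rewrite form_norm_sqr semi_innerDl !semi_innerDr (semi_innerC y x) -!form_norm_sqr.
by have := semi_inner_CS x y; rewrite sqrrD => h; lra.
Qed.

Lemma form_normN x : N (- x) = N x.
Proof. by rewrite -scaleN1r form_normZ normrN1 mul1r. Qed.

Lemma form_norm0 : N 0 = 0.
Proof. by rewrite -[X in N X](scale0r 0) form_normZ normr0 mul0r. Qed.

End SemiInnerProducts.

Section ComplexNorm.
Context (R : realType) (V : lmodType R) (b : V -> V -> R) (hb : semi_inner b).
Local Notation N := (form_norm b).
Local Notation NC := (complex_norm N).

(** The real part of the Hermitian extension of [b]; its norm is [complex_norm], which thereby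
    inherits the triangle inequality. *)
Let bC (x y : V * V) := b x.1 y.1 + b x.2 y.2.

Let bC_form : semi_inner bC.
Proof.
split.
- by move=> x y; rewrite /bC (semi_innerC hb x.1) (semi_innerC hb x.2).
- move=> a x y z; rewrite /bC /= !(semi_innerDl hb) !(semi_innerZl hb); ring.
- by move=> x; rewrite /bC addr_ge0 //; case: hb.
Qed.

Let NCE x : NC x = form_norm bC x.
Proof. by rewrite /complex_norm !(form_norm_sqr hb). Qed.

Lemma complex_norm_ge0 x : 0 <= NC x. Proof. exact: sqrtr_ge0. Qed.

Lemma complex_norm_triangle x y : NC (x + y) <= NC x + NC y.
Proof. by rewrite !NCE; apply: form_norm_triangle. Qed.

Lemma complex_normN x : NC (- x) = NC x.
Proof. by rewrite !NCE; apply: form_normN. Qed.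

Lemma complex_normZ (z : R[i]) x :
  NC (z *: x) = Num.sqrt (complex.Re z ^+ 2 + complex.Im z ^+ 2) * NC x.
Proof.
rewrite -sqrtrM ?addr_ge0 ?sqr_ge0 // /complex_norm; congr Num.sqrt.
case: z x => c s [x y] /=; rewrite !(form_norm_sqr hb) /=.
rewrite -scaleNr !(semi_innerDl hb) !(semi_innerDr hb) !(semi_innerZl hb) !(semi_innerZr hb).
rewrite (semi_innerC hb y x); ring.
Qed.

Lemma complex_norm_sqr x : NC x ^+ 2 = N x.1 ^+ 2 + N x.2 ^+ 2.
Proof. by rewrite /complex_norm sqr_sqrtr // addr_ge0 ?sqr_ge0. Qed.

Lemma complex_norm_le x : NC x <= N x.1 + N x.2.
Proof.
rewrite -(@ler_pXn2r _ 2) ?nnegrE ?addr_ge0 ?complex_norm_ge0 ?form_norm_ge0 //.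
rewrite complex_norm_sqr sqrrD addrAC lerDl mulrn_wge0 //.
by rewrite mulr_ge0 ?form_norm_ge0.
Qed.

End ComplexNorm.

(** * Quasimodes and contraction semigroups *)

Lemma limf_esup_pinfty_ge (R : realType) (f : R -> \bar R) (c : \bar R) :
  (forall M, exists2 x, M <= x & (c <= f x)%E) -> (c <= limf_esup f +oo%R)%E.
Proof.
move=> hf; rewrite limf_esupE; apply: le_ereal_inf_tmp => _ [V [M [Mr MV]] <-].
have [x Mx cx] := hf (M + 1).
apply: (le_trans cx); apply: ereal_sup_ubound; exists x => //.
by apply: MV; rewrite (lt_le_trans _ Mx) // ltrDl.
Qed.

Lemma difference_quotient_cvg (R : realType) (f : R -> R) (x d : R) :
  is_derive x 1 f d -> h^-1 * (f (x + h) - f x) @[h --> 0^'+] --> d.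
Proof.
move=> [fx fd]; rewrite -fd; have /cvg_dnbhs_at_right := fx.
apply: cvg_trans; apply: near_eq_cvg; near=> h.
rewrite /=.
by rewrite (_ : h%:A = h) ?[x + h]addrC //; exact: mulr1.
Unshelve. all: by end_near.
Qed.

(** Real part of (S(h) z - e^{i la h} z) / h = [(S(h) z - z) / h - y] - [i la z - y] -
    [(e^{i la h} - 1) / h - i la] z, where a = S(h) x1 / h, b = x1 / h, l = la x2, c = cos(la h) x1
    / h and s = sin(la h) x2 / h. The next lemma is the imaginary part. *)
Lemma difference_quotient_id1 (V : zmodType) (a b y l c s : V) :
  a - (c - s) = a - b - y - (- l - y) - (c - b - (s - l)).
Proof.
rewrite !(opprB, opprD, opprK) !addrA.
by rewrite [RHS](ACl (1*6*9*(2*8)*(3*5)*(4*7))) /= !addNr subrr !addr0.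
Qed.

Lemma difference_quotient_id2 (V : zmodType) (a b y l c s : V) :
  a - (c + s) = a - b - y - (l - y) - (c - b + (s - l)).
Proof.
rewrite !(opprB, opprD, opprK) !addrA.
by rewrite [RHS](ACl (1*7*9*(2*6)*(3*4)*(5*8))) /= !addNr !addr0.
Qed.

Section Quasimodes.
Context (R : realType) (V : lmodType R) (b : V -> V -> R) (hb : semi_inner b).
Local Notation N := (form_norm b).
Local Notation NC := (complex_norm N).
Local Notation VC := (complexification V).
Context (T : graph V).

(** The residual [f] is normalised instead of [z]: then [z] is itself a value of the resolvent on
    the unit ball, and its size bounds the resolvent norm from below. *)
Definition quasimodes (kappa q : R) := forall M : R,
  exists (la : R) (z f : VC), [/\ M <= la,
    graph_shift (Complex 0 la) (complex_graph T) z f, NC f <= 1 &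
    kappa * la `^ q <= NC z].

Lemma resolvent_limsup_gt0 (kappa q : R) : 0 < kappa -> quasimodes kappa q ->
  (0 < limf_esup (fun la : R => (la `^ (- q))%:E * resolvent_norm N T la) +oo%R)%E.
Proof.
move=> k0 hq; apply: (@lt_le_trans _ _ kappa%:E); first by rewrite lte_fin.
apply: limf_esup_pinfty_ge => M.
have [la [z [f [laM zf f1 kz]]]] := hq (Num.max M 1).
move: laM; rewrite ge_max => /andP[laM la1].
exists la => //.
have la0 : 0 < la by lra.
apply: (@le_trans _ _ ((la `^ (- q))%:E * (NC z)%:E)%E).
  rewrite -EFinM lee_fin powRN mulrC ler_pdivlMr ?powR_gt0 //.
rewrite lee_pmul2l ?lte_fin ?powR_gt0 //.
by apply: ereal_sup_ubound; exists z => //; exists f.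
Qed.

Section Semigroup.
Context (S : R -> V -> V) (hS : contraction_semigroup N S).

Let SC h (z : VC) : VC := (S h z.1, S h z.2).
Let e (a : R) : R[i] := Complex (cos a) (sin a).

Let Slin h : 0 <= h -> linear (S h). Proof. by case: hS => + _ _ _ _; apply. Qed.

Let SD h x y : 0 <= h -> S h (x + y) = S h x + S h y.
Proof. by move=> h0; have := Slin h0 1 x y; rewrite !scale1r. Qed.

Let S00 h : 0 <= h -> S h 0 = 0.
Proof.
by move=> h0; have := SD 0 0 h0; rewrite addr0 -[X in X = _]addr0 => /addrI.
Qed.

Let SZ h a x : 0 <= h -> S h (a *: x) = a *: S h x.
Proof. by move=> h0; have := Slin h0 a x 0; rewrite S00 // !addr0. Qed.

Let SN h x : 0 <= h -> S h (- x) = - S h x.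
Proof. by move=> h0; rewrite -scaleN1r SZ // scaleN1r. Qed.

Let SCB h (x y : VC) : 0 <= h -> SC h (x - y) = SC h x - SC h y.
Proof. by move=> h0; rewrite /SC /= !SD // !SN. Qed.

Let SCZ h (a : R[i]) (x : VC) : 0 <= h -> SC h (a *: x) = a *: SC h x.
Proof.
move=> h0; case: a => a1 a2.
by congr pair; rewrite /= ?SD // ?SN // !SZ.
Qed.

Let SC_contr h (z : VC) : 0 <= h -> NC (SC h z) <= NC z.
Proof.
move=> h0; apply: ler_wsqrtr; rewrite lerD // lerXn2r ?nnegrE ?form_norm_ge0 //;
by case: hS => _ _ _ + _; apply.
Qed.

Let e_add a c : e (a + c) = e a * e c.
Proof. by rewrite /e cosD sinD; congr Complex; rewrite addrC. Qed.

Let e_norm a (z : VC) : NC (e a *: z) = NC z.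
Proof. by rewrite complex_normZ //= cos2Dsin2 sqrtr1 mul1r. Qed.

(** Writing E for multiplication by e^{i th}, S^{n+1} - E^{n+1} = S (S^n - E^n) + E^n (S - E); [S]
    contracts and E is an isometry, so each step adds at most one single-step error. *)
Let telescope h th (z : VC) n : 0 <= h ->
  NC (SC (n%:R * h) z - e (n%:R * th) *: z) <= n%:R * NC (SC h z - e th *: z).
Proof.
move=> h0; elim: n => [|n IH].
  rewrite !mul0r /SC /e cos0 sin0 (_ : Complex 1 0 = 1) // scale1r.
  have S0 x : S 0 x = x by case: hS => _ + _ _ _; apply.
  by rewrite !S0 -surjective_pairing subrr /complex_norm /= !form_norm0 // expr0n /= addr0 sqrtr0.
have -> : SC (n.+1%:R * h) z - e (n.+1%:R * th) *: z =
  SC h (SC (n%:R * h) z - e (n%:R * th) *: z) + e (n%:R * th) *: (SC h z - e th *: z).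
  rewrite SCB // SCZ // scalerBr scalerA -e_add addrA subrK; congr (_ - _).
    rewrite /SC /=; have hS' x : S (n.+1%:R * h) x = S h (S (n%:R * h) x).
      case: hS => _ _ + _ _ => <-; rewrite ?mulr_ge0 //.
      by rewrite -natr1 mulrDl mul1r addrC.
    by rewrite !hS'.
  by rewrite -[in LHS]natr1 mulrDl mul1r.
apply: (le_trans (complex_norm_triangle hb _ _)).
rewrite e_norm -natr1 mulrDl mul1r lerD2r; apply: le_trans IH.
exact: SC_contr.
Qed.

(* Telescope S(t) z - e^{i la t} z over n steps of length t / n and let n grow. *)
Lemma semigroup_quasimode (la t : R) (x1 x2 y1 y2 : V) :
  generator N S x1 y1 -> generator N S x2 y2 -> 0 < t ->
  NC (x1, x2) <= NC (S t x1, S t x2) +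
    t * NC (Complex 0 la *: ((x1, x2) : VC) - (y1, y2) : VC).
Proof.
move=> g1 g2 t0; set z : VC := (x1, x2).
rewrite -[(S t x1, _)]/(SC t z); set f : VC := Complex 0 la *: z - _.
pose c h := h^-1 * (cos (la * h) - 1).
pose s h := h^-1 * sin (la * h) - la.
(* The part of the single-step error, per unit of time, that vanishes as h tends to 0: the
   difference quotient of [S] against the generator, and that of e^{i la h} against i la. What
   remains is [NC f]. *)
pose r h := N (h^-1 *: (S h x1 - x1) - y1) + N (h^-1 *: (S h x2 - x2) - y2) +
   (`|c h| + `|s h|) * NC z.
have r0 : r h @[h --> 0^'+] --> (0 : R).
  have cs0 : (`|c h| + `|s h|) * NC z @[h --> 0^'+] --> (0 : R).
    have c0 : c h @[h --> 0^'+] --> (0 : R).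
      have D : is_derive (0 : R) 1 (fun h : R => cos (la * h)) 0.
        apply: is_derive_eq; rewrite mulr0 sin0 oppr0 mul0r //.
      have := difference_quotient_cvg D.
      by under eq_fun do rewrite add0r mulr0 cos0.
    have s0 : s h @[h --> 0^'+] --> (0 : R).
      have D : is_derive (0 : R) 1 (fun h : R => sin (la * h)) la.
        apply: is_derive_eq; rewrite mulr0 cos0 mul1r.
        exact: mulr1.
      have := difference_quotient_cvg D.
      under eq_fun do rewrite add0r mulr0 sin0 subr0.
      rewrite -[X in _ -> _ --> X](subrr la) => sh; apply: (cvgB sh); exact: cvg_cst.
    rewrite -[X in _ --> X](mul0r (NC z)); apply: cvgMr_tmp.
    rewrite -[X in _ --> X](addr0 0).
    by apply: cvgD; rewrite -[X in _ --> X](normr0 R); apply: cvg_norm.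
  by rewrite -[X in _ --> X]addr0 -[X in X + _]addr0; apply: cvgD cs0; apply: cvgD.
have step h : 0 < h -> NC (SC h z - e (la * h) *: z) <= h * (NC f + r h).
  move=> h0; set d : VC := (h^-1 *: (S h x1 - x1) - y1, h^-1 *: (S h x2 - x2) - y2).
  have -> : SC h z - e (la * h) *: z =
      Complex h 0 *: (d - f - Complex (c h) (s h) *: z).
    have ch : c h = h^-1 * cos (la * h) - h^-1 by rewrite /c mulrBr mulr1.
    have csx x : c h *: x = h^-1 *: (cos (la * h) *: x) - h^-1 *: x.
      by rewrite ch scalerBl scalerA.
    have ssx x : s h *: x = h^-1 *: (sin (la * h) *: x) - la *: x.
      by rewrite /s scalerBl scalerA.
    have hK (v : V) : h *: (h^-1 *: v) = v.
      by rewrite scalerA divff ?gt_eqF // scale1r.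
    rewrite /SC /e /f /d /z; congr pair => /=; rewrite !(scale0r, subr0, addr0).
      rewrite sub0r csx ssx (scalerBr h^-1) -difference_quotient_id1.
      by rewrite !(scalerBr h) !hK.
    rewrite add0r csx ssx (scalerBr h^-1) -difference_quotient_id2.
    by rewrite scalerBr scalerDr !hK.
  rewrite complex_normZ //= expr0n addr0 sqrtr_sqr gtr0_norm // ler_pM2l //.
  apply: (le_trans (complex_norm_triangle hb _ _)); rewrite complex_normN //.
  rewrite complex_normZ //= /r addrA; apply: lerD.
    apply: (le_trans (complex_norm_triangle hb _ _)); rewrite complex_normN //.
    by rewrite [leRHS]addrC lerD2r complex_norm_le.
  rewrite ler_wpM2r ?complex_norm_ge0 //.
  rewrite -(@ler_pXn2r _ 2) ?nnegrE ?addr_ge0 ?sqrtr_ge0 ?normr_ge0 //.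
  rewrite [leLHS]sqr_sqrtr ?addr_ge0 ?sqr_ge0 // [leRHS]sqrrD !real_normK ?num_real //.
  by rewrite addrAC lerDl mulrn_wge0 ?mulr_ge0.
apply/ler_addgt0Pr => d d0.
have : \forall h \near 0^'+, r h < d / t.
  by apply: cvgr_lt r0 _ _; rewrite divr_gt0.
move=> [eps /= eps0 hr].
pose n := Num.truncn (t / eps).
have n0 : 0 < n.+1%:R :> R by rewrite ltr0n.
have tn : t = n.+1%:R * (t / n.+1%:R) by rewrite mulrCA divff ?gt_eqF // mulr1.
have h0 : 0 < t / n.+1%:R by rewrite divr_gt0.
have rd : r (t / n.+1%:R) < d / t.
  apply: hr => //=; rewrite sub0r normrN gtr0_norm // ltr_pdivrMr //.
  by rewrite mulrC -ltr_pdivrMr // truncnS_gt.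
have := telescope (la * (t / n.+1%:R)) z n.+1 (ltW h0).
rewrite -tn => /le_trans /(_ (ler_wpM2l (ltW n0) (step _ h0))).
rewrite [X in _ <= X -> _]mulrA -tn => hT.
have := complex_norm_triangle hb (SC t z) (- (SC t z - e (n.+1%:R * (la * (t / n.+1%:R))) *: z)).
rewrite opprB addrC subrK e_norm -opprB complex_normN // => /le_trans; apply.
rewrite -addrA lerD2l; apply: (le_trans hT).
rewrite mulrDr lerD2l; apply: ltW.
by rewrite mulrC -ltr_pdivlMr.
Qed.

End Semigroup.

Lemma decay_limsup_gt0 (S : R -> V -> V) (kappa q : R) : 0 < kappa -> 0 < q ->
  quasimodes kappa q -> generates N T S ->
  (0 < limf_esup (fun t : R => (t `^ (1 / q))%:E * decay_norm N T S t) +oo%R)%E.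
Proof.
move=> k0 q0 hq [hS gT].
have Slin h : 0 <= h -> linear (S h) by case: hS => + _ _ _ _; apply.
have SZ h a x : 0 <= h -> S h (a *: x) = a *: S h x.
  move=> h0; have := Slin h h0 a x 0; rewrite addr0 => ->.
  have := Slin h h0 1 0 0; rewrite scaler0 scale1r addr0 => /eqP.
  by rewrite -subr_eq subrr => /eqP <-; rewrite addr0.
(* [T] is a bare graph; homogeneity is inherited from the generator of the linear maps S(h). *)
have TZ a x y : T x y -> T (a *: x) (a *: y).
  rewrite -!gT /generator => g.
  rewrite -[X in _ --> X](mulr0 `|a|).
  apply: cvg_trans (cvgMl_tmp (a := `|a|) g); apply: near_eq_cvg.
  near=> h; rewrite /= SZ // -scalerBr scalerA (mulrC h^-1) -scalerA -scalerBr.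
  by rewrite form_normZ.
pose k := (kappa / 2) `^ (1 / q).
have kp : 0 < k by rewrite powR_gt0 // divr_gt0.
apply: (@lt_le_trans _ _ (k / 4)%:E); first by rewrite lte_fin divr_gt0.
apply: limf_esup_pinfty_ge => M.
have [la [z [f [laM [y Ty fE] f1 kz]]]] :=
  (* The bound by 1 gives la^q >= 1, hence |z| >= kappa; the second gives la |z| > 1; the third puts
     the time t below beyond [M]. *)
  hq (Num.max (Num.max 1 (kappa^-1 + 1)) ((2 * `|M| / kappa) `^ (1 / q))).
move: laM; rewrite !ge_max => /andP[/andP[la1 lak] laM].
have la0 : 0 < la by lra.
(* Half of the lower bound for |z|, so that the drift t |f| is at most |z| / 2; moreover t^{1/q} is
   exactly a multiple of la. *)
pose t := kappa / 2 * la `^ q.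
have t0 : 0 < t by rewrite mulr_gt0 ?powR_gt0 // divr_gt0.
have laq1 : 1 <= la `^ q.
  have -> : 1 = 1 `^ q :> R by rewrite powR1.
  by apply: ge0_ler_powR; rewrite ?nnegrE ?ler01 ?(ltW la0) ?(ltW q0).
exists t.
  have : (2 * `|M| / kappa) <= la `^ q.
    have M0 : 0 <= 2 * `|M| / kappa by rewrite divr_ge0 ?mulr_ge0 // ltW.
    have -> : 2 * `|M| / kappa = ((2 * `|M| / kappa) `^ (1 / q)) `^ q.
      by rewrite -powRrM div1r mulVf ?gt_eqF // powRr1.
    by apply: ge0_ler_powR; rewrite ?nnegrE ?powR_ge0 ?(ltW la0) ?(ltW q0).
  rewrite ler_pdivrMr // => h; apply: (le_trans (ler_norm M)).
  by rewrite /t; lra.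
have tq : t `^ (1 / q) = k * la.
  have k2 : 0 <= kappa / 2 by rewrite divr_ge0 // ltW.
  rewrite powRM ?powR_ge0 // -powRrM div1r divff ?gt_eqF //.
  by rewrite powRr1 ?ltW // /k div1r.
rewrite tq.
have -> : (k / 4)%:E = ((k * la)%:E * (4 * la)^-1%:E)%E.
  by rewrite -EFinM; congr EFin; field; rewrite gt_eqF.
rewrite lee_pmul2l ?lte_fin ?mulr_gt0 // leNgt; apply/negP => D.
(* If the decay norm were below d, then |S(t) z| <= d |y| <= d (la |z| + 1) < d (2 la |z|) = |z| /
   2, which together with the drift contradicts |z| <= |S(t) z| + t |f|. *)
set d := (4 * la)^-1 in D.
have d0 : 0 < d by rewrite invr_gt0 mulr_gt0.
have bd x x' : T x x' -> N (S t x) <= d * N x'.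
  move=> Tx; apply/ler_addgt0Pr => e e0.
  (* The extra e / d keeps the normalisation meaningful when N x' = 0. *)
  pose a := (N x' + e / d)^-1.
  have ed : 0 < N x' + e / d by rewrite ltr_wpDl ?form_norm_ge0 // divr_gt0.
  have a0 : 0 < a by rewrite invr_gt0.
  have : ((N (S t (a *: x)))%:E <= d%:E)%E.
    apply: le_trans (ltW D); apply: ereal_sup_ubound.
    exists (S t (a *: x)) => //; exists (a *: x') => /=; last first.
      by exists (a *: x) => //; exact: TZ.
    rewrite form_normZ // gtr0_norm // mulrC ler_pdivrMr // mul1r lerDl.
    by rewrite divr_ge0 ?ltW.
  rewrite lee_fin SZ ?(ltW t0) // form_normZ // gtr0_norm // mulrC ler_pdivrMr //.
  by rewrite mulrDr (mulrCA d) divff ?gt_eqF // mulr1.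
case: z y Ty fE kz => [z1 z2] [y1 y2] [/= Ty1 Ty2] fE kz.
have /(_ t t0) /= := semigroup_quasimode hS la (proj2 (gT _ _) Ty1) (proj2 (gT _ _) Ty2).
rewrite -fE => hz.
have sz : NC (S t z1, S t z2) <= d * NC (y1, y2).
  rewrite -(@ler_pXn2r _ 2) ?nnegrE ?mulr_ge0 ?complex_norm_ge0 ?(ltW d0) //.
  rewrite exprMn !complex_norm_sqr /= mulrDr -!exprMn.
  by apply: lerD; rewrite lerXn2r ?nnegrE ?mulr_ge0 ?form_norm_ge0 ?(ltW d0) // bd.
set Z := NC (z1, z2) in hz kz.
have ny : NC (y1, y2) <= la * Z + 1.
  have -> : (y1, y2) = Complex 0 la *: ((z1, z2) : VC) - f :> VC.
    by rewrite fE opprB addrC subrK.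
  apply: (le_trans (complex_norm_triangle hb _ _)).
  rewrite complex_normZ // complex_normN // /= expr0n add0r sqrtr_sqr gtr0_norm //.
  by rewrite lerD2l.
have Zk : kappa <= Z by apply: le_trans kz; rewrite ler_pMr.
have laZ : 1 < la * Z.
  apply: (@lt_le_trans _ _ (la * kappa)); last by rewrite ler_pM2l.
  by rewrite -ltr_pdivrMr // div1r (lt_le_trans _ lak) // ltrDl.
have tf : t * NC f <= Z / 2.
  apply: (@le_trans _ _ t); first by rewrite ler_piMr // ltW.
  by rewrite /t; lra.
have : d * NC (y1, y2) < d * (2 * la * Z) by rewrite ltr_pM2l //; lra.
have -> : d * (2 * la * Z) = Z / 2 by rewrite /d; field; rewrite gt_eqF.
by move=> ?; lra.
Unshelve. all: by end_near.
Qed.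

End Quasimodes.

(** * Hilbert spaces *)

Section HilbertSpaces.
Context (R : realType) (H : hilbertType R).
Implicit Types x y z : H.

Lemma dot_semi_inner : semi_inner (@dot R H).
Proof.
split; first exact: dotC; last by move=> x; rewrite dot_norm sqr_ge0.
by move=> a x y z; rewrite dotDl dotZl.
Qed.

Lemma dot_form_norm x : form_norm (@dot R H) x = `|x|.
Proof. by rewrite /form_norm dot_norm sqrtr_sqr normr_id. Qed.

Lemma dotDr x y z : dot z (x + y) = dot z x + dot z y.
Proof. exact: (semi_innerDr dot_semi_inner). Qed.

Lemma dotZr a x z : dot z (a *: x) = a * dot z x.
Proof. exact: (semi_innerZr dot_semi_inner). Qed.

Lemma dotNl x z : dot (- x) z = - dot x z.
Proof. by rewrite -scaleN1r dotZl mulN1r. Qed.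

Lemma dotNr x z : dot z (- x) = - dot z x.
Proof. by rewrite dotC dotNl dotC. Qed.

Lemma dotBl x y z : dot (x - y) z = dot x z - dot y z.
Proof. by rewrite dotDl dotNl. Qed.

Lemma dotBr x y z : dot z (x - y) = dot z x - dot z y.
Proof. by rewrite dotDr dotNr. Qed.

Lemma dot0l z : dot 0 z = 0.
Proof. by rewrite -(subrr z) dotBl subrr. Qed.

Lemma dot_CS x y : `|dot x y| <= `|x| * `|y|.
Proof.
have h (u v : H) : dot u v <= `|u| * `|v|.
  by have := semi_inner_CS dot_semi_inner u v; rewrite !dot_form_norm.
by rewrite ler_norml h andbT lerNl -dotNl -(normrN x) h.
Qed.

Lemma normB_sqr x y : `|x - y| ^+ 2 = `|x| ^+ 2 - 2 * dot x y + `|y| ^+ 2.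
Proof. by rewrite -!dot_norm !dotBl !dotBr (dotC y x); ring. Qed.

Lemma parallelogram x y :
  `|x + y| ^+ 2 + `|x - y| ^+ 2 = 2 * `|x| ^+ 2 + 2 * `|y| ^+ 2.
Proof. by rewrite -!dot_norm !(dotDl, dotNl, dotDr, dotNr); ring. Qed.

Lemma cvg_dotl (T : Type) (F : set_system T) {FF : Filter F} (f : T -> H) x y :
  f @ F --> x -> dot (f t) y @[t --> F] --> dot x y.
Proof.
move=> /cvgrPdist_lt fx; apply/cvgrPdist_lt => e e0.
have y0 : 0 < `|y| + 1 by rewrite ltr_wpDl.
near=> t; rewrite -dotBl; apply: (le_lt_trans (dot_CS _ _)).
apply: (@le_lt_trans _ _ (`|x - f t| * (`|y| + 1))).
  by rewrite ler_wpM2l // lerDl.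
rewrite -ltr_pdivlMr //; near: t; apply: fx.
by rewrite divr_gt0.
Unshelve. all: by end_near.
Qed.

Lemma cauchy_seq_cvg (r : nat -> H) :
  (forall e, 0 < e -> exists n0, forall n, (n0 <= n)%N -> `|r n0 - r n| < e) ->
  exists l : H, r @ \oo --> l.
Proof.
move=> hr; suff /cauchy_cvg/cvg_ex[l rl] : cauchy (r @ \oo) by exists l.
apply: cauchy_exP => e e0; have [n0 hn] := hr e e0.
exists (r n0); exists n0 => // n /= n0n.
by rewrite -ball_normE /=; exact: hn.
Qed.

(* Projection onto the subspace: a minimising sequence is Cauchy by the        *)
(* parallelogram identity.                                                    *)
Lemma closed_subspace_eqT (M : set H) :
  M 0 -> (forall a x y, M x -> M y -> M (a *: x + y)) ->
  (forall (r : nat -> H) (l : H), (forall n, M (r n)) -> r @ \oo --> l -> M l) ->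
  (forall y, (forall x, M x -> dot x y = 0) -> y = 0) -> M = setT.
Proof.
move=> M0 Mlin Mcl Mort; apply/seteqP; split=> // f _.
pose D := [set `|f - r| ^+ 2 | r in M].
have D0 : has_inf D.
  split; first by exists (`|f - 0| ^+ 2); exists 0.
  by exists 0 => _ [r _ <-]; exact: sqr_ge0.
have Dlb r : M r -> inf D <= `|f - r| ^+ 2.
  by move=> Mr; apply: ge_inf; [case: D0 | exists r].
have /choice[r hr] (n : nat) : exists r, M r /\ `|f - r| ^+ 2 < inf D + n.+1%:R^-1.
  have [|_ [r Mr <-] h] := @inf_adherent _ D n.+1%:R^-1 _ D0.
    by rewrite invr_gt0 ltr0n.
  by exists r.
have [l rl] : exists l : H, r @ \oo --> l.
  apply: cauchy_seq_cvg => e e0.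
  (* The midpoint of [r n0] and [r n] lies in [M], so the parallelogram identity gives |r n0 - r
     n|^2 < 2 / (n0 + 1) + 2 / (n + 1) <= 4 / (n0 + 1) < e^2. *)
  pose n0 := Num.truncn (4 / e ^+ 2); exists n0 => n n0n.
  rewrite -(@ltr_pXn2r _ 2) ?nnegrE ?(ltW e0) //.
  have [M1 h1] := hr n0; have [M2 h2] := hr n.
  have := parallelogram (f - r n0) (f - r n).
  have -> : f - r n0 - (f - r n) = - (r n0 - r n).
    by rewrite opprB addrC addrA subrK opprB.
  have -> : f - r n0 + (f - r n) = 2 *: (f - 2^-1 *: (1 *: r n0 + r n)).
    rewrite scale1r scalerBr scalerA divff // scale1r scaler_nat mulr2n.
    by rewrite addrACA -opprD.
  rewrite normrN normrZ exprMn => pe.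
  have := Dlb _ (Mlin 2^-1 _ _ (Mlin 1 _ _ M1 M2) M0); rewrite addr0 => lb.
  have hn : n.+1%:R^-1 <= n0.+1%:R^-1 :> R by rewrite lef_pV2 ?posrE ?ltr0n // ler_nat ltnS.
  have he : 4 * n0.+1%:R^-1 < e ^+ 2.
    rewrite ltr_pdivrMr ?ltr0n // mulrC -ltr_pdivrMr ?exprn_gt0 //.
    exact: truncnS_gt.
  have aux (d i0 i E X Y a b : R) : 2 ^+ 2 * X + Y = 2 * a + 2 * b -> d <= X ->
      i <= i0 -> 4 * i0 < E -> a < d + i0 -> b < d + i -> Y < E by lra.
  by move: pe; rewrite ger0_norm // => pe; exact: (aux _ _ _ _ _ _ _ _ pe lb hn he h1 h2).
have Ml := Mcl _ _ (fun n => (hr n).1) rl.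
have ld : `|f - l| ^+ 2 <= inf D.
  have cl : `|f - r n| ^+ 2 @[n --> \oo] --> `|f - l| ^+ 2.
    by apply: cvgM; apply: cvg_norm; apply: cvgB => //; exact: cvg_cst.
  have ci : inf D + n.+1%:R^-1 @[n --> \oo] --> inf D.
    rewrite -[X in _ --> X]addr0; apply: cvgD; first exact: cvg_cst.
    exact: cvg_harmonic.
  apply: (ler_cvg_to cl ci); near=> n; exact: ltW (hr n).2.
have : f - l = 0.
  apply: Mort => s Ms.
  (* Minimality of [l] along the line l + a s; the optimal a then forces orthogonality to [s]. *)
  have key a : 0 <= a ^+ 2 * `|s| ^+ 2 - 2 * a * dot (f - l) s.
    have := Dlb _ (Mlin a _ _ Ms Ml).
    rewrite opprD addrCA addrC normB_sqr dotZr normrZ exprMn real_normK ?num_real //.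
    by move=> h; lra.
  rewrite dotC; set c := dot _ _ in key *.
  have [s0|s0] := eqVneq `|s| 0.
    by apply/eqP; rewrite -normr_le0 /c (le_trans (dot_CS _ _)) // s0 mulr0.
  have := key (c / `|s| ^+ 2); rewrite expr_div_n.
  have -> : c ^+ 2 / (`|s| ^+ 2) ^+ 2 * `|s| ^+ 2 - 2 * (c / `|s| ^+ 2) * c = - (c / `|s|) ^+ 2.
    by field.
  rewrite oppr_ge0 => h; have : (c / `|s|) ^+ 2 == 0 by rewrite eq_le h sqr_ge0.
  by rewrite sqrf_eq0 mulf_eq0 invr_eq0 (negbTE s0) orbF => /eqP.
by move=> /eqP; rewrite subr_eq0 => /eqP ->.
Unshelve. all: by end_near.
Qed.

End HilbertSpaces.

(** * Approximate eigenvectors of unbounded self-adjoint operators *)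

Lemma near_dist_lt (R : realType) (b e : R) : 0 < e -> \forall c \near b, `|b - c| < e.
Proof. by move=> e0; have := nbhsx_ballx b e e0; rewrite -ball_normE. Qed.

Section SelfAdjoint.
Context (R : realType) (H : hilbertType R) (A : operator H).
Hypothesis saA : self_adjoint A.

Lemma operator_symmetric x y : dom A x -> dom A y -> dot (A x) y = dot x (A y).
Proof.
move=> Ax Ay; have [_ h] := saA.
by have [h1 _] := h y (A y); exact: h1.
Qed.

Lemma operator0 : A 0 = 0.
Proof.
have := apply_linear 1 (dom0 A) (dom0 A); rewrite !scale1r addr0.
by move=> /eqP; rewrite -subr_eq subrr => /eqP.
Qed.

Lemma operatorD x y : dom A x -> dom A y -> dom A (x + y) /\ A (x + y) = A x + A y.
Proof.
move=> Ax Ay; have := dom_linear 1 Ax Ay; have := apply_linear 1 Ax Ay.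
by rewrite !scale1r.
Qed.

Lemma operatorZ a x : dom A x -> dom A (a *: x) /\ A (a *: x) = a *: A x.
Proof.
move=> Ax; have := dom_linear a Ax (dom0 A); have := apply_linear a Ax (dom0 A).
by rewrite operator0 !addr0.
Qed.

Lemma operatorB x y : dom A x -> dom A y -> dom A (x - y) /\ A (x - y) = A x - A y.
Proof.
move=> Ax Ay; rewrite -(scaleN1r y) -[- A y]scaleN1r; have [d1 e1] := operatorZ (-1) Ay.
by have [d2 e2] := operatorD Ax d1; rewrite e2 e1.
Qed.

(** The lower bound makes preimages of convergent sequences Cauchy, and a self-adjoint operator is
    closed, so the range of A - al is closed. A vector orthogonal to it lies in the kernel of A - al
    by self-adjointness, and the lower bound makes it zero. *)
Lemma self_adjoint_shift_surjective (al e : R) : 0 < e ->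
  (forall x, dom A x -> e * `|x| <= `|A x - al *: x|) ->
  forall f, exists2 w, dom A w & A w - al *: w = f.
Proof.
move=> e0 hA f.
pose M := [set A w - al *: w | w in dom A].
suff : M f by case=> w Aw <-; exists w.
rewrite (@closed_subspace_eqT _ _ M) //.
- by exists 0; [exact: dom0 | rewrite operator0 scaler0 subrr].
- move=> a _ _ [x Ax <-] [y Ay <-]; exists (a *: x + y); first exact: dom_linear.
  rewrite apply_linear // scalerDr scalerBr scalerA mulrC -scalerA.
  by rewrite opprD addrACA.
- move=> r l hr rl.
  have /choice[w hw] n : exists w, dom A w /\ A w - al *: w = r n.
    by have [w Aw wE] := hr n; exists w.
  have Aw n : dom A (w n) by have [] := hw n.
  have rE n : r n = A (w n) - al *: w n by have [] := hw n.
  have dw m n : e * `|w m - w n| <= `|r m - r n|.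
    have [d E] := operatorB (Aw m) (Aw n); have := hA _ d.
    by rewrite E scalerBr !rE !opprD !opprK addrACA.
  have [x wx] : exists x : H, w @ \oo --> x.
    apply: cauchy_seq_cvg => d d0.
    have [n0 _ hn0] : \forall n \near \oo, `|l - r n| < e * d / 2.
      by move/cvgrPdist_lt : rl; apply; rewrite divr_gt0 ?mulr_gt0.
    exists n0 => n n0n; rewrite -(ltr_pM2l e0); apply: (le_lt_trans (dw _ _)).
    have := hn0 _ n0n; have := hn0 n0 (leqnn _) => /= h1 h2.
    have := ler_distD l (r n0) (r n); rewrite (distrC (r n0) l); lra.
  have Awl : A (w n) @[n --> \oo] --> l + al *: x.
    rewrite (_ : (fun n => _) = (fun n => r n + al *: w n)); last first.
      by apply/funext => n; rewrite rE subrK.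
    by apply: cvgD => //; exact: cvgZl_tmp.
  have [dx Ax] : dom A x /\ A x = l + al *: x.
    have [_ h] := saA; apply/h => y Ay.
    have c1 : dot (A (w n)) y @[n --> \oo] --> dot (l + al *: x) y by exact: cvg_dotl.
    have c2 : dot (w n) (A y) @[n --> \oo] --> dot x (A y) by exact: cvg_dotl.
    rewrite [RHS]dotC [LHS]dotC; apply: (norm_cvg_unique c2) => /=.
    suff <- : (fun n => dot (A (w n)) y) = (fun n => dot (w n) (A y)) by [].
    by apply/funext => n; rewrite operator_symmetric.
  by exists x => //; rewrite Ax addrK.
- move=> y hy.
  have [dy Ay] : dom A y /\ A y = al *: y.
    have [_ h] := saA; apply/h => x Ax.
    have := hy (A x - al *: x); rewrite dotBl dotZl dotZr => h0.
    by apply/eqP; rewrite -subr_eq0 h0 //; exists x.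
  have := hA y dy; rewrite Ay subrr normr0 pmulr_rle0 // normr_le0.
  by move/eqP.
Qed.

Section ResolventHalfLine.
Variable M : R.
Hypothesis hM : forall al, M <= al ->
  exists2 e, 0 < e & forall x, dom A x -> e * `|x| <= `|A x - al *: x|.

(* al |-> <(A - al)^{-1} u, u> has derivative |(A - al)^{-1} u|^2, hence solves *)
(* a Riccati inequality on [M, +oo) and would blow up if it became positive.   *)
Lemma resolvent_nonpositive al u : M < al -> dom A u ->
  dot u (A u - al *: u) <= 0.
Proof.
move=> Mal Au; set f := A u - al *: u.
(* [r b] is (A - b)^{-1} f with [f] fixed; values at b < M are junk. *)
have /choice[r hr] (b : R) : exists w, M <= b -> dom A w /\ A w - b *: w = f.
  case: (leP M b) => [Mb|_]; last by exists 0.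
  have [e e0 he] := hM Mb.
  by have [w Aw wE] := self_adjoint_shift_surjective e0 he f; exists w.
have dr b : M <= b -> dom A (r b) by move=> /hr[].
have rE b : M <= b -> A (r b) - b *: r b = f by move=> /hr[].
pose g b := dot (r b) f.
have gB b c : M <= b -> M <= c -> g c - g b = (c - b) * dot (r b) (r c).
  move=> Mb Mc; rewrite /g -{1}(rE _ Mb) -(rE _ Mc) !dotBr !dotZr.
  rewrite -(operator_symmetric (dr _ Mc) (dr _ Mb)) (dotC (r c) (r b)) (dotC (A _)).
  ring.
(* From (A - b)(r c - r b) = (c - b) r c: once |c - b| <= e / 2, the share of |r c - r b| hidden in
   |r c| is absorbed by the lower bound e at [b]. *)
have rc b : M < b -> r x @[x --> b] --> r b.
  move=> Mb; have [e e0 he] := hM (ltW Mb).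
  have rB c : M <= c -> e * `|r c - r b| <= `|c - b| * `|r c|.
    move=> Mc; have [d E] := operatorB (dr _ Mc) (dr _ (ltW Mb)).
    have := he _ d; rewrite E; set X := (X in _ <= `|X| -> _).
    suff -> : X = (c - b) *: r c by rewrite normrZ.
    have -> : X = (A (r c) - b *: r c) - (A (r b) - b *: r b).
      by rewrite /X scalerBr !opprB addrACA [RHS]addrACA [- A _ + _]addrC.
    by rewrite (rE b) ?ltW // -(rE _ Mc) opprB addrC addrA subrK scalerBl.
  apply/cvgrPdist_lt => d d0.
  pose K := `|r b| + 1.
  have K0 : 0 < K by rewrite ltr_wpDl.
  near=> c.
  have Mc : M <= c.
    have : `|b - c| < b - M by near: c; apply: near_dist_lt; rewrite subr_gt0.
    by move=> /(le_lt_trans (ler_norm _)) ?; lra.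
  have cb : `|c - b| <= e / 2.
    rewrite distrC; apply: ltW; near: c.
    by apply: near_dist_lt; rewrite divr_gt0.
  have cd : `|c - b| < e * d / (2 * K).
    rewrite distrC; near: c.
    by apply: near_dist_lt; rewrite divr_gt0 ?mulr_gt0.
  have h1 := rB _ Mc; have h2 : `|r c| <= `|r b| + `|r c - r b|.
    by rewrite -{1}(subrK (r b) (r c)) addrC ler_normD.
  rewrite distrC; set n := `|r c - r b| in h1 h2 *.
  have h3 : `|c - b| * `|r c| <= `|c - b| * K + e / 2 * n.
    apply: (@le_trans _ _ (`|c - b| * (K + n))).
      by rewrite ler_wpM2l // (le_trans h2) // lerD2r lerDl.
    by rewrite mulrDr lerD2l ler_wpM2r // /n normr_ge0.
  rewrite -(ltr_pM2l e0).
  have h4 : `|c - b| * K < e * d / 2.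
    by move: cd; rewrite invfM mulrA ltr_pdivlMr.
  lra.
have gd b : M < b -> is_derive b 1 g (`|r b| ^+ 2).
  move=> Mb; have L : h^-1 *: (g (h *: 1 + b) - g b) @[h --> 0^'] --> `|r b| ^+ 2.
    have : dot (r (h + b)) (r b) @[h --> 0^'] --> `|r b| ^+ 2.
      rewrite -dot_norm; apply: cvg_dotl.
      have rb : r (h + b) @[h --> (0 : R)] --> r b.
        have bc : h + b @[h --> (0 : R)] --> b.
          rewrite -[X in _ --> X]add0r; apply: cvgD; first exact: cvg_id.
          exact: cvg_cst.
        exact: (cvg_comp _ _ bc (rc _ Mb)).
      exact: cvg_trans (cvg_app _ (@nbhs_dnbhs _ (0 : R))) rb.
    apply: cvg_trans; apply: near_eq_cvg; near=> h.
    have hE : h *: 1 + b = h + b by congr (_ + _); exact: mulr1.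
    rewrite hE (gB b) ?(ltW Mb) //; last first.
      have : `|h| < b - M.
        by near: h; apply: dnbhs0_lt; rewrite subr_gt0.
      by rewrite ltr_norml => /andP[? _]; lra.
    by rewrite addrK /= dotC [RHS]mulrA mulVf ?mul1r //; near: h; exact: nbhs_dnbhs_neq.
  by apply: DeriveDef; [exact: cvgP L | exact: cvg_lim L].
rewrite leNgt; apply/negP => gpos.
have Mal' := ltW Mal.
have rf : r al = u.
  have [e e0 he] := hM Mal'.
  have [d E] := operatorB (dr _ Mal') Au.
  have := he _ d; rewrite E scalerBr.
  have -> : A (r al) - A u - (al *: r al - al *: u) =
     (A (r al) - al *: r al) - (A u - al *: u).
    by rewrite !opprB addrACA [RHS]addrACA [- A u + _]addrC.
  rewrite (rE _ Mal') -/f subrr normr0 pmulr_rle0 // normr_le0 subr_eq0.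
  by move/eqP.
have g0 : 0 < g al by rewrite /g rf.
have f0 : 0 < `|f|.
  rewrite normr_gt0; apply/eqP => f0; move: g0.
  by rewrite /g f0 dotC dot0l ltxx.
(* Cauchy-Schwarz turns g' = |r|^2 into (1 / g)' <= - 1 / |f|^2, so 1 / g would have dropped to at
   most - 1 / |f|^2 at this c, although g increases from a positive value. *)
pose c := al + `|f| ^+ 2 / g al + 1.
have alc : al < c.
  by rewrite /c -addrA ltrDl ltr_wpDl // divr_ge0 ?sqr_ge0 ?ltW.
have gmono b : al <= b -> g al <= g b.
  move=> alb; have [x xab||] := @MVT_segment _ g (fun x => `|r x| ^+ 2) _ _ alb.
  - by apply: gd; move: xab; rewrite in_itv /= => /andP[/(lt_trans Mal)].
  - apply: derivable_within_continuous => x; rewrite in_itv /= => /andP[alx _].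
    by have [] := gd x (lt_le_trans Mal alx).
  - by move=> x _ e; rewrite -subr_ge0 e mulr_ge0 ?sqr_ge0 // subr_ge0.
pose h b := (g b)^-1; pose dh b := - (g b) ^- 2 *: (`|r b| ^+ 2 : R).
have hd b : al <= b -> is_derive b 1 h (dh b).
  move=> alb; apply: is_deriveV; first by rewrite gt_eqF // (lt_le_trans g0) // gmono.
  exact: gd (lt_le_trans Mal alb).
have [x xab||] := @MVT_segment _ h dh _ _ (ltW alc).
- by apply: hd; move: xab; rewrite in_itv /= => /andP[/ltW].
- apply: derivable_within_continuous => x; rewrite in_itv /= => /andP[alx _].
  by have [] := hd x alx.
move=> x; rewrite in_itv /= => /andP[alx _] E.
have gx : 0 < g x by rewrite (lt_le_trans g0) // gmono.
have hc : 0 < h c by rewrite invr_gt0 (lt_le_trans g0) // gmono // ltW.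
have dhx : dh x <= - (`|f| ^- 2).
  have gr : g x <= `|r x| * `|f| by apply: le_trans (ler_norm _) (dot_CS _ _).
  rewrite /dh -[_ *: _]/(_ * _) mulNr lerN2 mulrC ler_pdivlMr ?exprn_gt0 //.
  rewrite mulrC ler_pdivrMr ?exprn_gt0 // -exprMn lerXn2r ?nnegrE ?mulr_ge0 //.
  exact: ltW.
have : h c - h al <= - (`|f| ^- 2) * (c - al).
  by rewrite E ler_wpM2r // subr_ge0 ltW.
have -> : - (`|f| ^- 2) * (c - al) = - (h al) - `|f| ^- 2.
  by rewrite /c /h; field; rewrite !gt_eqF.
have : 0 < `|f| ^- 2 by rewrite invr_gt0 exprn_gt0.
lra.
Unshelve. all: by end_near.
Qed.

End ResolventHalfLine.

(** Cauchy-Schwarz for the form <A x, y> gives <A u, v> <= c |u| |v| for v in the domain, density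
    extends this to every v, and v = A u concludes. *)
Lemma operator_bounded_of_form_bounded (c : R) : 0 <= c ->
  (forall u, dom A u -> 0 <= dot (A u) u) ->
  (forall u, dom A u -> dot (A u) u <= c * `|u| ^+ 2) ->
  forall u, dom A u -> `|A u| <= c * `|u|.
Proof.
move=> c0 Age0 Ale u Au.
pose b (x y : dom_type A) := dot (A (dom_val x)) (dom_val y).
have dv (x : dom_type A) : dom A (dom_val x) by case: x => x /= /asboolP.
have hb : semi_inner b.
  split=> [x y|a x y z|x]; rewrite /b.
  - by rewrite operator_symmetric // dotC.
  - have -> : dom_val (a *: x + y) = a *: dom_val x + dom_val y by [].
    by rewrite apply_linear // dotDl dotZl.
  - exact: Age0.
have nb (x : dom_type A) : form_norm b x <= Num.sqrt c * `|dom_val x|.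
  rewrite -(ger0_norm (normr_ge0 (dom_val x))) -sqrtr_sqr -sqrtrM //.
  exact/ler_wsqrtr/Ale.
have mem x (Ax : dom A x) : x \in dom_pred A by apply/asboolP.
have bnd v : dom A v -> dot (A u) v <= c * `|u| * `|v|.
  move=> Av; pose x := DomType (mem _ Au); pose y := DomType (mem _ Av).
  apply: (le_trans (semi_inner_CS hb x y)).
  apply: (@le_trans _ _ ((Num.sqrt c * `|u|) * (Num.sqrt c * `|v|))).
    by apply: ler_pM; rewrite ?form_norm_ge0 //; exact: nb.
  by rewrite mulrACA -expr2 sqr_sqrtr // mulrA.
have bnd' v : dot (A u) v <= c * `|u| * `|v|.
  apply/ler_addgt0Pr => e e0.
  pose d := e / (c * `|u| + `|A u| + 1).
  have k0 : 0 < c * `|u| + `|A u| + 1 by rewrite ltr_wpDl // addr_ge0 // mulr_ge0.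
  have d0 : 0 < d by rewrite divr_gt0.
  have [dA _] := saA.
  have [|x [vx Ax]] := dA (ball v d) _ (ball_open v d); first by exists v; exact: ballxx.
  move: vx; rewrite -ball_normE /= => vx.
  have h1 := bnd _ Ax.
  have h2 : dot (A u) (v - x) <= `|A u| * d.
    by apply: (le_trans (ler_norm _)); apply: (le_trans (dot_CS _ _)); rewrite ler_wpM2l // ltW.
  have h3 : `|x| <= `|v| + d.
    by rewrite -(subKr v x) (le_trans (ler_normB _ _)) // lerD2l ltW.
  have h4 : c * `|u| * `|x| <= c * `|u| * `|v| + c * `|u| * d.
    by rewrite -mulrDr ler_wpM2l // mulr_ge0.
  have h5 : d * (c * `|u| + `|A u| + 1) = e by rewrite /d divfK ?gt_eqF.
  move: h2; rewrite dotBr; lra.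
have [A0|A0] := eqVneq `|A u| 0; first by rewrite A0 mulr_ge0.
by have := bnd' (A u); rewrite dot_norm expr2 ler_pM2r // lt_def A0 normr_ge0.
Qed.

(** Otherwise A - al is bounded below for each al >= M, and the preceding lemmas make [A] bounded.
    The value al is independent of the accuracy [e]. *)
Lemma approximate_eigenvectors (M : R) : unbounded A ->
  (forall u, dom A u -> 0 <= dot (A u) u) ->
  exists2 al, M <= al & forall e, 0 < e ->
    exists w, [/\ dom A w, w != 0 & `|A w - al *: w| <= e * `|w|].
Proof.
move=> ubA Age0; apply: contrapT => no; apply: ubA.
pose c := Num.max M 0 + 1.
have Mc : M < c by rewrite ltr_pwDr // le_max lexx.
have c0 : 0 <= c by rewrite /c addr_ge0 // le_max lexx orbT.
exists c; apply: operator_bounded_of_form_bounded => // u Au.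
have hM al : M <= al ->
    exists2 e, 0 < e & forall x, dom A x -> e * `|x| <= `|A x - al *: x|.
  move=> Mal; apply: contrapT => no'; apply: no; exists al => // e e0.
  apply: contrapT => no''; apply: no'; exists e => // x Ax.
  rewrite leNgt; apply/negP => lt; apply: no''; exists x; split=> //.
    by apply/eqP => x0; move: lt; rewrite x0 normr0 mulr0 ltNge normr_ge0.
  exact: ltW.
have := resolvent_nonpositive hM Mc Au.
by rewrite dotBr dotZr dot_norm (dotC u) subr_le0.
Qed.

End SelfAdjoint.

(** * Oscillatory integrals *)

Section Translation.
Context (R : realType).
Local Notation leb := (@lebesgue_measure R).
Variable h : R.
Let phi (s : measurableTypeR R) : measurableTypeR R := s + h.

Let mphi : measurable_fun setT phi.
Proof. by apply: measurable_funD. Qed.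

Let pushE (A : set R) : measurable A -> pushforward leb phi A = leb A.
Proof.
move=> mA; apply/esym/lebesgue_measure_unique => //= _ [[a b]] _ <-.
rewrite /pushforward.
have -> : phi @^-1` `]a, b] = `]a - h, b - h]%classic.
  by apply/seteqP; split=> s; rewrite /= !in_itv /= /phi ltrBlDr lerBrDr.
rewrite !lebesgue_measure_itv /= !lte_fin ltrD2r.
by case: ifP => // _; rewrite -!EFinB; congr EFin; ring.
Qed.

Lemma integrable_translate (f : R -> R) : leb.-integrable setT (EFin \o f) ->
  leb.-integrable setT (fun s => (f (s + h))%:E).
Proof.
move=> /integrableP[/measurable_EFinP mf foo].
have mfh : measurable_fun setT (fun s : R => f (s + h)) by exact: measurableT_comp mf mphi.
apply/integrableP; split; first exact/measurable_EFinP.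
suff -> : (\int[leb]_s `|(f (s + h))%:E| = \int[leb]_s `|(f s)%:E|)%E by [].
rewrite -[RHS](@eq_measure_integral _ _ _ _ leb (pushforward leb phi)); last first.
  by move=> A mA _; exact: pushE.
rewrite ge0_integral_pushforward //.
by apply: measurableT_comp => //; exact/measurable_EFinP.
Qed.

Lemma Rintegral_translate (f : R -> R) : leb.-integrable setT (EFin \o f) ->
  \int[leb]_s f (s + h) = \int[leb]_s f s.
Proof.
move=> fi; have fhi := integrable_translate fi.
have mf : measurable_fun setT (EFin \o f) by case/integrableP : fi.
congr fine.
rewrite -[RHS](@eq_measure_integral _ _ _ _ leb (pushforward leb phi)); last first.
  by move=> A mA _; exact: pushE.
by rewrite integral_pushforward.
Qed.

End Translation.

Section OscillatoryIntegral.
Context (R : realType).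
Local Notation leb := (@lebesgue_measure R).

Lemma integrable_mul_bounded (D : set R) (f g : R -> R) (c : R) : measurable D ->
  leb.-integrable D (EFin \o f) -> measurable_fun D g ->
  (forall s, D s -> `|g s| <= c) ->
  leb.-integrable D (fun s => (f s * g s)%:E).
Proof.
move=> mD fi mg gc.
have mf : measurable_fun D f by case/integrableP : fi => /measurable_EFinP.
apply: (@le_integrable _ _ _ leb _ mD _ (fun s => (c%:E * (f s)%:E)%E)).
- by apply/measurable_EFinP; exact: measurable_funM.
- move=> s Ds; rewrite -EFinM !abse_EFin lee_fin !normrM mulrC ler_wpM2r //.
  by rewrite (le_trans (gc _ Ds)) // ler_norm.
- exact: integrableZl.
Qed.

(* Since [e] is antiperiodic, shifting by [h] gives                           *)
(* [2 * int nu e = int (nu s - nu (s + h)) e s ds].                           *)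
Lemma antiperiodic_integral_bound (nu e : R -> R) (h : R) : 0 < h ->
  leb.-integrable setT (EFin \o nu) ->
  (forall s, 0 <= nu s) -> (forall s, s <= 0 -> nu s = 0) ->
  (forall s t, 0 < s -> s <= t -> nu t <= nu s) ->
  measurable_fun setT e -> (forall s, `|e s| <= 1) ->
  (forall s, e (s + h) = - e s) ->
  `|\int[leb]_s (nu s * e s)| <= \int[leb]_(s in `]-oo, h]) nu s.
Proof.
move=> h0 nui nu0 nuneg nuI me e1 eh.
pose b (s : R) : R := if s <= h then 1 else 0.
pose k s := nu s * b s.
have mb : measurable_fun setT b.
  by apply: measurable_fun_ifT => //; exact: measurable_fun_ler.
have nuei : leb.-integrable setT (fun s => (nu s * e s)%:E).
  by apply: (integrable_mul_bounded (c := 1)).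
have nuhi := integrable_translate h nui.
have nuhei : leb.-integrable setT (fun s => (nu (s + h) * e s)%:E).
  by apply: (@integrable_mul_bounded _ (fun s => nu (s + h)) _ 1).
have ki : leb.-integrable setT (EFin \o k).
  apply: (@integrable_mul_bounded _ nu _ 1) => // s _.
  by rewrite /b; case: ifP => _; rewrite ?normr1 ?normr0.
have -> : \int[leb]_(s in `]-oo, h]) nu s = \int[leb]_s k s.
  rewrite Rintegral_mkcond; apply: eq_Rintegral => s _.
  by rewrite /k /b patchE mem_setE in_itv /=; case: ifP => _; rewrite ?mulr1 ?mulr0.
have I2 : 2 * \int[leb]_s (nu s * e s) = \int[leb]_s ((nu s - nu (s + h)) * e s).
  have E : \int[leb]_s (nu s * e s) = - \int[leb]_s (nu (s + h) * e s).
    rewrite -(Rintegral_translate h nuei).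
    under eq_Rintegral do rewrite eh mulrN -mulN1r.
    by rewrite RintegralZl // mulN1r.
  rewrite mulr_natl mulr2n {2}E -RintegralB //.
  by apply: eq_Rintegral => s _; rewrite mulrBl.
have di : leb.-integrable setT (fun s => ((nu s - nu (s + h)) * e s)%:E).
  have := integrableB measurableT nuei nuhei.
  by apply: eq_integrable => // s _ /=; rewrite mulrBl EFinB.
rewrite -(ler_pM2l (@ltr0n R 2)) -{1}(ger0_norm (ler0n R 2)) -normrM I2.
apply: (le_trans (le_normr_Rintegral _ di)) => //.
have khi := integrable_translate h ki.
(* On s > 0 monotonicity makes nu s - nu (s + h) its own absolute value. On s <= 0 the absolute
   value is nu (s + h), and the correction 2 k (s + h) restores the sign there. After integration
   the first two terms cancel, leaving twice the integral of [k]. *)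
pose B s := nu s - nu (s + h) + 2 * k (s + h).
have Bi : leb.-integrable setT (EFin \o B).
  have := integrableD measurableT (integrableB measurableT nui nuhi)
    (integrableZl measurableT 2 khi).
  by apply: eq_integrable => // s _.
apply: (@le_trans _ _ (\int[leb]_s B s)).
  apply: le_Rintegral => //; first exact: integrable_norm di.
  move=> s _; rewrite normrM; apply: (@le_trans _ _ `|nu s - nu (s + h)|).
    by rewrite ler_piMr.
  rewrite /B /k /b; have [s0|s0] := leP s 0.
    have -> : s + h <= h by lra.
    by rewrite nuneg // mulr1 sub0r normrN ger0_norm //; have := nu0 (s + h); lra.
  have -> : (s + h <= h) = false by apply/negbTE; rewrite -ltNge; lra.
  rewrite !mulr0 addr0 ger0_norm // subr_ge0.
  by rewrite nuI // lerDl ltW.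
rewrite RintegralD //; last 2 first.
  by have := integrableB measurableT nui nuhi; apply: eq_integrable.
  by have := integrableZl measurableT 2 khi; apply: eq_integrable.
rewrite RintegralB // (Rintegral_translate h nui) subrr add0r RintegralZl //.
by rewrite (Rintegral_translate h ki).
Qed.

End OscillatoryIntegral.

Section FTC.
Context (R : realType).
Local Notation leb := (@lebesgue_measure R).

Lemma derivable_LRcontinuous (F : R -> R) (a b : R) : a <= b ->
  (forall x, a <= x <= b -> derivable F x 1) -> derivable_oo_LRcontinuous F a b.
Proof.
move=> ab dF.
have cF x : a <= x <= b -> {for x, continuous F}.
  by move=> /dF; move/derivable1_diffP/differentiable_continuous.
split.
- by move=> x; rewrite in_itv /= => /andP[/ltW ax /ltW xb]; apply: dF; rewrite ax.
- by apply: cvg_at_right_filter; apply: cF; rewrite lexx ab.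
- by apply: cvg_at_left_filter; apply: cF; rewrite lexx ab.
Qed.

(** The primitive s^{1-p} used below is controlled only away from 0, so the fundamental theorem is
    applied on [a, h] and a is sent to 0 by continuity of the integral in its endpoint. *)
Lemma Rintegral_le_near0 (g : R -> R) (h : R) (C : R) : 0 < h ->
  leb.-integrable setT (EFin \o g) -> (forall s, s < 0 -> g s = 0) ->
  (forall a, 0 < a -> a < h -> \int[leb]_(s in `]a, h]) g s <= C) ->
  \int[leb]_(s in `]-oo, h]) g s <= C.
Proof.
move=> h0 gi gneg gC.
have gih : leb.-integrable `[0, h]%classic (EFin \o g) by exact: integrableS gi.
have -> : \int[leb]_(s in `]-oo, h]) g s = \int[leb]_(s in `[0, h]) g s.
  rewrite Rintegral_mkcond [RHS]Rintegral_mkcond; apply: eq_Rintegral => s _.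
  rewrite !patchE !mem_setE !in_itv /=.
  by case: (leP 0 s) => //= s0; case: ifP => // _; exact: gneg.
apply/ler_addgt0Pr => e e0.
have /nbhs_ballP[d /= d0 hd] := parameterized_integral_near_left h0 e0 gih.
pose a := Num.min d h / 2.
have m0 : 0 < Num.min d h by rewrite lt_min d0.
have a0 : 0 < a by rewrite divr_gt0.
have am : a < Num.min d h by rewrite /a; lra.
have ad : a < d by rewrite (lt_le_trans am) // ge_min lexx.
have ah : a < h by rewrite (lt_le_trans am) // ge_min lexx orbT.
have := hd a; rewrite -ball_normE /= sub0r normrN gtr0_norm // => /(_ ad (ltW a0)).
rewrite /parameterized_integral => /(le_lt_trans (ler_norm _)) sm.
have := @Rintegral_itvB _ g (BLeft 0) (BRight h) a gih.
rewrite !bnd_simp => /(_ (ltW a0) (ltW ah)) E.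
have := gC a a0 ah; rewrite -E; lra.
Qed.

Lemma integral_powRN_bound (g : R -> R) (c p h : R) : 0 <= c -> p < 1 -> 0 < h ->
  leb.-integrable setT (EFin \o g) ->
  (forall s, s < 0 -> g s = 0) ->
  (forall s, 0 < s -> s <= h -> g s <= c * s `^ (- p)) ->
  \int[leb]_(s in `]-oo, h]) g s <= c / (1 - p) * h `^ (1 - p).
Proof.
move=> c0 p1 h0 gi gneg gle.
have q0 : 0 < 1 - p by lra.
apply: Rintegral_le_near0 => // a a0 ah.
pose F s := c / (1 - p) * s `^ (1 - p).
pose f s := c * s `^ (- p).
have dF (s : R) : 0 < s -> is_derive s 1 F (f s).
  move=> s0; have -> : f s = (c / (1 - p)) *: ((1 - p) * s `^ ((1 - p) - 1)) :> R.
    rewrite /f -[_ *: _]/(_ * _) mulrA divfK ?gt_eqF //.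
    by congr (_ * _ `^ _); ring.
  exact: (is_deriveZ (c / (1 - p)) (is_derive1_powR (1 - p) s0)).
have df (s : R) : 0 < s -> derivable f s 1.
  move=> s0; apply: derivableM => //; have [] := is_derive1_powR (- p) s0; done.
have cf : {within `[a, h], continuous f}.
  apply: derivable_within_continuous => s; rewrite in_itv /= => /andP[as_ _].
  by apply: df; exact: lt_le_trans as_.
have fi : leb.-integrable `[a, h]%classic (EFin \o f).
  by apply: continuous_compact_integrable => //; exact: segment_compact.
have sub : (`]a, h]%classic : set R) `<=` `[a, h]%classic by exact: subset_itv_oc_cc.
apply: (@le_trans _ _ (\int[leb]_(s in `]a, h]) f s)).
  apply: le_Rintegral => //.
  - exact: integrableS gi.
  - exact: integrableS fi.
  - move=> s; rewrite /= in_itv /= => /andP[as_ sh]; apply: gle => //.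
    exact: lt_trans as_.
rewrite Rintegral_itv_obnd_cbnd; last exact: integrableS fi.
rewrite /Rintegral (@continuous_FTC2 _ f F) //.
- by rewrite -EFinB /= lerBlDr lerDl /F mulr_ge0 ?powR_ge0 // divr_ge0 // ltW.
- apply: derivable_LRcontinuous; first exact: ltW.
  by move=> s /andP[as_ _]; have [] := dF s (lt_le_trans a0 as_).
- move=> s; rewrite in_itv /= => /andP[as_ _].
  by have [_ <-] := dF s (lt_trans a0 as_); rewrite derive1E.
Qed.

End FTC.

(** * Decay of the Fourier transform of the kernel *)

Section Kernel.
Context (R : realType) (mu : memory_kernel R).
Local Notation leb := (@lebesgue_measure R).
Local Notation I := (history mu).

Lemma kernel_integrable : leb.-integrable I (EFin \o mu).
Proof.
exact: (@integrableS _ _ _ leb `]0, +oo[%classic _ _ (measurable_itv _)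
  (@measurable_history R mu) (@history_sub R mu) (kernel_summable mu)).
Qed.

Lemma patched_kernel_integrable : leb.-integrable setT (EFin \o (mu \_ I)).
Proof.
have mI := @measurable_history R mu.
by rewrite -restrict_EFin; apply/integrable_restrict => //; rewrite setTI; exact: kernel_integrable.
Qed.

(** Extension by zero outside the history interval keeps the kernel nonincreasing on (0, +oo), since
    that interval starts at 0 and the kernel is nonnegative. *)
Lemma kernel_antiperiodic_bound (e : R -> R) (h : R) : 0 < h ->
  measurable_fun setT e -> (forall s, `|e s| <= 1) ->
  (forall s, e (s + h) = - e s) ->
  `|\int[leb]_(s in I) (mu s * e s)| <= \int[leb]_(s in `]-oo, h]) (mu \_ I) s.
Proof.
move=> h0 me e1 eh.
have -> : \int[leb]_(s in I) (mu s * e s) = \int[leb]_s ((mu \_ I) s * e s).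
  rewrite Rintegral_mkcond; apply: eq_Rintegral => s _.
  by rewrite !patchE; case: ifP => // _; rewrite mul0r.
have nuE s : (mu \_ I) s = if s \in I then mu s else 0 by rewrite patchE.
apply: antiperiodic_integral_bound => //.
- exact: patched_kernel_integrable.
- move=> s; rewrite nuE; case: ifP => // /set_mem[s0 _].
  exact: kernel_ge0.
- by move=> s s0; rewrite nuE; case: ifP => // /set_mem[]; rewrite ltNge s0.
- move=> s t s0 st; rewrite !nuE; case: ifP => [/set_mem[t0 tI]|_].
    rewrite mem_set; first exact: kernel_nonincreasing.
    by split=> //; apply: le_lt_trans tI; rewrite lee_fin.
  by case: ifP => // _; exact: kernel_ge0.
Qed.

Lemma kernel_oscillation (p l : R) : 0 <= p < 1 -> 0 < l ->
  s `^ p * mu s @[s --> 0^'+] --> l ->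
  exists2 K, 0 < K & exists L, forall (la : R) (e : R -> R), L <= la -> 0 < la ->
    measurable_fun setT e -> (forall s, `|e s| <= 1) ->
    (forall s, e (s + pi / la) = - e s) ->
    `|\int[leb]_(s in I) (mu s * e s)| <= K * la `^ (p - 1).
Proof.
move=> /andP[p0 p1] l0 mul.
have : \forall s \near 0^'+, s `^ p * mu s < l + 1.
  by apply: (cvgr_lt _ mul); rewrite ltrDl.
move=> [d /= d0 hd].
have pi0 := pi_gt0 R.
exists ((l + 1) / (1 - p) * pi `^ (1 - p)).
  by rewrite mulr_gt0 ?powR_gt0 // divr_gt0 // ?subr_gt0 // addr_gt0.
(* Ensures pi / la < d, so that mu s <= (l + 1) s^{-p} on the whole half period; integrating this
   gives the constant above. *)
exists (2 * pi / d) => la e Lla la0 me e1 eh.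
have h0 : 0 < pi / la by rewrite divr_gt0.
apply: (le_trans (kernel_antiperiodic_bound h0 me e1 eh)).
have -> : (l + 1) / (1 - p) * pi `^ (1 - p) * la `^ (p - 1) =
    (l + 1) / (1 - p) * (pi / la) `^ (1 - p).
  rewrite -mulrA -[p - 1]opprB powRN; congr (_ * _).
  rewrite powRM ?invr_ge0 ?ltW //; congr (_ * _).
  have -> : la^-1 = la `^ (-1) by rewrite powR_inv1 // ltW.
  by rewrite -powRrM mulN1r powRN.
apply: integral_powRN_bound => //.
- by rewrite addr_ge0 // ltW.
- exact: patched_kernel_integrable.
- move=> s s0; rewrite patchE; case: ifP => // /set_mem[/ltW].
  by rewrite leNgt s0.
move=> s s0 sh.
apply: (@le_trans _ _ (mu s)).
  by rewrite patchE; case: ifP => // _; exact: kernel_ge0.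
rewrite powRN ler_pdivlMr ?powR_gt0 // mulrC; apply: ltW; apply: hd => //=.
rewrite sub0r normrN gtr0_norm //; apply: (le_lt_trans sh).
rewrite ltr_pdivrMr // mulrC -ltr_pdivrMr // (lt_le_trans _ Lla) //.
by rewrite -mulrA ltr_pMl ?divr_gt0 // ltr1n.
Qed.

End Kernel.

(** * The phase space *)

Section AeEqual.
Context (R : realType).
Local Notation leb := (@lebesgue_measure R).
Variables (D : set R) (mD : measurable D) (f g : R -> R).
Hypotheses (mf : measurable_fun D f) (mg : measurable_fun D g).
Hypothesis fg : ae_eq leb D f g.

Lemma ae_eq_Rintegral : \int[leb]_(s in D) f s = \int[leb]_(s in D) g s.
Proof.
congr fine; apply: ae_eq_integral => //; try exact/measurable_EFinP.
by apply: filterS fg => s E Ds; rewrite E.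
Qed.

Lemma ae_eq_integrable : leb.-integrable D (EFin \o f) -> leb.-integrable D (EFin \o g).
Proof.
move=> /integrableP[_ foo]; apply/integrableP; split; first exact/measurable_EFinP.
apply: le_lt_trans foo; rewrite le_eqVlt; apply/orP; left; apply/eqP.
apply: ae_eq_integral => //.
- by apply: measurableT_comp => //; exact/measurable_EFinP.
- by apply: measurableT_comp => //; exact/measurable_EFinP.
- by apply: filterS fg => s E Ds /=; rewrite E.
Qed.

End AeEqual.

Section MemoryForm.
Context (R : realType) (H : hilbertType R) (mu : memory_kernel R).
Local Notation leb := (@lebesgue_measure R).
Local Notation I := (history mu).
Local Notation M := (memory_space H mu).
Local Open Scope quotient_scope.

Let mI : measurable I := @measurable_history R mu.

Lemma dot_polarization (x y : H) :
  dot x y = (`|x + y| ^+ 2 - `|x| ^+ 2 - `|y| ^+ 2) / 2.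
Proof. by rewrite -!dot_norm dotDl !dotDr (dotC y x); field. Qed.

(** Polarisation reduces this to norms, whose measurability is known for strongly measurable
    functions. *)
Lemma strongly_measurable_dot (f g : R -> H) :
  strongly_measurable f -> strongly_measurable g ->
  measurable_fun setT (fun s => dot (f s) (g s)).
Proof.
move=> mf mg.
have mfg : strongly_measurable (f + g).
  by have := strongly_measurable_lincomb 1 mf mg; rewrite scale1r.
under eq_fun do rewrite dot_polarization.
apply: measurable_funM => //.
apply: measurable_funB; last exact: measurable_funX (strongly_measurable_norm mg).
apply: measurable_funB; last exact: measurable_funX (strongly_measurable_norm mf).
exact: measurable_funX (strongly_measurable_norm mfg).
Qed.

Lemma L2_strongly_measurable (f : L2_fun H mu) : strongly_measurable f.
Proof. by case: f => f /= /asboolP[]. Qed.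

Lemma L2_integrable (f : L2_fun H mu) :
  leb.-integrable I (fun s => (mu s * `|f s| ^+ 2)%:E).
Proof. by case: f => f /= /asboolP[]. Qed.

Lemma measurable_kernel_dot (f g : R -> H) :
  strongly_measurable f -> strongly_measurable g ->
  measurable_fun I (fun s => mu s * dot (f s) (g s)).
Proof.
move=> mf mg; apply: measurable_funM; first exact: kernel_measurable.
exact: measurable_funTS (strongly_measurable_dot mf mg).
Qed.

Lemma kernel_dot_integrable (f g : L2_fun H mu) :
  leb.-integrable I (fun s => (mu s * dot (f s) (g s))%:E).
Proof.
apply: (@le_integrable _ _ _ leb _ mI _
  (fun s => (mu s * `|f s| ^+ 2)%:E + (mu s * `|g s| ^+ 2)%:E)%E).
- by apply/measurable_EFinP; apply: measurable_kernel_dot; exact: L2_strongly_measurable.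
- move=> s [s0 _]; have m0 := kernel_ge0 mu s0.
  rewrite -EFinD !abse_EFin lee_fin normrM -mulrDr normrM ler_wpM2l //.
  rewrite (le_trans (dot_CS _ _)) // ger0_norm ?addr_ge0 ?sqr_ge0 //.
  have := sqr_ge0 (`|f s| - `|g s|); have := sqr_ge0 `|f s|; have := sqr_ge0 `|g s|.
  rewrite sqrrB; lra.
- by apply: integrableD => //; exact: L2_integrable.
Qed.

(** Frees computations from the representatives picked by [repr], which are not linear in the
    class. *)
Lemma memory_dot_ae (x y : M) (f g : L2_fun H mu) :
  ae_eq leb I (repr x : L2_fun H mu) f -> ae_eq leb I (repr y : L2_fun H mu) g ->
  memory_dot x y = \int[leb]_(s in I) (mu s * dot (f s) (g s)).
Proof.
move=> xf yg; apply: ae_eq_Rintegral => //.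
- by apply: measurable_kernel_dot; exact: L2_strongly_measurable.
- by apply: measurable_kernel_dot; exact: L2_strongly_measurable.
- by move: yg; apply: filterS2 xf => s E1 E2 Is; rewrite E1 // E2.
Qed.

Lemma memory_dot_semi_inner : semi_inner (@memory_dot R H mu).
Proof.
split.
- by move=> x y; apply: eq_Rintegral => s _; rewrite dotC.
- move=> a x y z.
  have e : ae_eq leb I (repr (a *: x + y) : L2_fun H mu)
      (a *: (repr x : L2_fun H mu) + (repr y : L2_fun H mu) : L2_fun H mu).
    apply/(@memory_space_eqP R H mu); rewrite reprK.
    rewrite -[in LHS](reprK x) -[in LHS](reprK y).
    by rewrite -[in RHS]memory_addE -memory_scaleE.
  rewrite (memory_dot_ae e (ae_eq_refl _ _ _)).
  rewrite -RintegralZl // ?(kernel_dot_integrable (repr x) (repr z)) //.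
  rewrite -RintegralD //.
  + by apply: eq_Rintegral => s _; rewrite /= dotDl dotZl mulrDr mulrCA.
  + apply: (@eq_integrable _ _ _ leb _ mI (fun s => a%:E *
      (mu s * dot ((repr x : L2_fun H mu) s) ((repr z : L2_fun H mu) s))%:E)%E) => //.
    by apply: integrableZl => //; exact: kernel_dot_integrable.
  + exact: kernel_dot_integrable.
- move=> x; apply: Rintegral_ge0 => s [s0 _].
  by rewrite mulr_ge0 ?kernel_ge0 // dot_norm sqr_ge0.
Qed.

Section PhaseForm.
Variable B : operator H.
Local Notation X := (phase_space B mu).

Definition phase_dot (x y : X) : R :=
  dot (B (dom_val x.1.1)) (B (dom_val y.1.1)) + dot x.1.2 y.1.2 +
  memory_dot x.2 y.2.

Lemma phase_dot_semi_inner : semi_inner phase_dot.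
Proof.
have dv (x : dom_type B) : dom B (dom_val x) by case: x => x /= /asboolP.
split.
- move=> x y; rewrite /phase_dot dotC (dotC x.1.2).
  by rewrite (semi_innerC memory_dot_semi_inner).
- move=> a [[u v] x] [[u' v'] x'] z; rewrite /phase_dot /=.
  rewrite apply_linear // !dotDl !dotZl.
  rewrite (semi_innerDl memory_dot_semi_inner) (semi_innerZl memory_dot_semi_inner).
  ring.
- move=> x; rewrite /phase_dot !addr_ge0 ?dot_norm ?sqr_ge0 //.
  by case: memory_dot_semi_inner.
Qed.

Lemma phase_normE : @phase_norm R H B mu = form_norm phase_dot.
Proof.
apply/funext => x; rewrite /phase_norm /form_norm /phase_dot !dot_norm.
by rewrite /memory_norm sqr_sqrtr //; case: memory_dot_semi_inner.
Qed.

End PhaseForm.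

End MemoryForm.

Section VectorMultiples.
Context (R : realType) (H : hilbertType R) (mu : memory_kernel R).
Local Notation leb := (@lebesgue_measure R).
Local Notation I := (history mu).
Local Notation M := (memory_space H mu).
Local Open Scope quotient_scope.

Let mI : measurable I := @measurable_history R mu.

Lemma strongly_measurable_scale (g : R -> R) (w : H) : measurable_fun setT g ->
  strongly_measurable (fun s => g s *: w).
Proof.
move=> mg; have mEg : measurable_fun setT (EFin \o g) by exact/measurable_EFinP.
have [f fg] := approximation_sfun measurableT mEg.
exists (fun n (s : R) => f n s *: w).
  move=> n; split.
    have := @fimfunP _ _ (f n).
    move=> /(finite_image (fun r => r *: w)); apply: sub_finite_set.
    by move=> _ [s _ <-]; exists (f n s) => //; exists s.
  move=> h.
  have -> : (fun s => f n s *: w) @^-1` [set h] =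
      \bigcup_(r in range (f n) `&` [set r | r *: w = h]) f n @^-1` [set r].
    apply/seteqP; split=> s /=; first by move=> E; exists (f n s) => //; split => //; exists s.
    by move=> [r [_ /= rh] /= ->].
  apply: fin_bigcup_measurable => //.
  by apply: finite_setIl; exact: fimfunP.
move=> s; apply: cvgZr_tmp.
by have /fine_cvgP[] := fg s Logic.I.
Qed.

Lemma scale_L2 (g : R -> R) (c : R) (w : H) : measurable_fun setT g ->
  (forall s, `|g s| <= c) -> ((fun s => g s *: w) : R -> H) \in L2_pred mu.
Proof.
move=> mg gc; apply/asboolP; split; first exact: strongly_measurable_scale.
have := @integrable_mul_bounded R I mu (fun s => `|g s *: w| ^+ 2) ((c * `|w|) ^+ 2)
  mI (kernel_integrable mu).
apply.
  apply: measurable_funX; apply: measurable_funTS.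
  exact: strongly_measurable_norm (strongly_measurable_scale w mg).
move=> s _; rewrite ger0_norm ?sqr_ge0 // normrZ.
have c0 : 0 <= c by rewrite (le_trans _ (gc s)).
by rewrite lerXn2r ?nnegrE ?mulr_ge0 // ler_wpM2r.
Qed.

(** The generator and the weak derivative integrate the chosen representative of a class; this lets
    the explicit function be integrated instead. *)
Lemma is_integral_repr (k : R -> R) (f : L2_fun H mu) (v : H) :
  measurable_fun I k ->
  is_integral I (fun s => k s *: f s) v ->
  is_integral I (fun s => k s *: (repr (\pi_M f) : L2_fun H mu) s) v.
Proof.
move=> mk fv h; have [fi fE] := fv h.
have m (r : L2_fun H mu) : measurable_fun I (fun s => dot (k s *: r s) h).
  under eq_fun do rewrite dotZl.
  apply: measurable_funM => //; apply: measurable_funTS.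
  apply: strongly_measurable_dot; first exact: L2_strongly_measurable.
  exact: strongly_measurable_cst.
have fr : ae_eq leb I (fun s => dot (k s *: f s) h)
    (fun s => dot (k s *: (repr (\pi_M f) : L2_fun H mu) s) h).
  by apply: filterS (ae_eq_repr f) => s E Is; rewrite E.
split; first exact: (ae_eq_integrable mI (m _) (m _) fr).
by rewrite -(ae_eq_Rintegral mI (m _) (m _) fr).
Qed.

Lemma is_integral_scale (k g : R -> R) (w : H) :
  leb.-integrable I (fun s => (k s * g s)%:E) ->
  is_integral I (fun s => k s *: (g s *: w)) ((\int[leb]_(s in I) (k s * g s)) *: w).
Proof.
move=> kgi h; under eq_fun do rewrite scalerA dotZl EFinM muleC.
split; first exact: integrableZl.
under eq_Rintegral do rewrite scalerA dotZl.
by rewrite RintegralZr // dotZl.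
Qed.

End VectorMultiples.

(** * Weak derivatives of smooth scalar multiples of a vector *)

Section WeakDerivatives.
Context (R : realType) (H : hilbertType R) (mu : memory_kernel R).
Local Notation leb := (@lebesgue_measure R).
Local Notation I := (history mu).
Local Notation M := (memory_space H mu).
Local Open Scope quotient_scope.

Let mI : measurable I := @measurable_history R mu.

Lemma history_open_up m : I m -> exists2 m', m < m' & I m'.
Proof.
move=> [m0 /ereal_sup_gt[_ [t [t0 mut] <-]]]; rewrite lte_fin => mt.
exists ((m + t) / 2); first lra.
split; first lra.
apply: (@lt_le_trans _ _ t%:E); first by rewrite lte_fin; lra.
by apply: ereal_sup_ubound; exists t.
Qed.

(** The given bounds may be unordered, and the derivative is to vanish at the endpoints as well.
    Hence the interval is widened: to a / 2 on the left, and on the right to a point of the history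
    beyond the maximum of both bounds, which exists because the history is open above. *)
Lemma test_function_support (phi : R -> R) : test_function mu phi ->
  exists a b, [/\ a < b, `[a, b]%classic `<=` I &
    (forall s, ~~ (a < s < b) -> phi s = 0) /\
    (forall s, ~~ (a < s < b) -> derive1 phi s = 0)].
Proof.
move=> [_ [a [b [Ia Ib phi0]]]].
have Im : I (Num.max a b) by rewrite maxEle; case: ifP.
have [b' mb' Ib'] := history_open_up Im.
have a0 : 0 < a by case: Ia.
have [ab' bb'] : a < b' /\ b < b' by apply/andP; rewrite -gt_max.
exists (a / 2), b'.
have out (s : R) : ~~ (a / 2 < s < b') -> \forall t \near s, phi t = 0.
  rewrite negb_and -!leNgt => /orP[sa|bs].
    near=> t; apply: phi0; rewrite negb_and -!ltNge; apply/orP; left.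
    near: t; apply: lt_nbhsl; lra.
  near=> t; apply: phi0; rewrite negb_and -!ltNge; apply/orP; right.
  near: t; apply: lt_nbhsr; lra.
split; first lra.
- move=> s; rewrite /= in_itv /= => /andP[as_ sb]; split; first lra.
  by apply: le_lt_trans Ib'.2; rewrite lee_fin.
- split=> s /out hs; first exact: nbhs_singleton hs.
  rewrite derive1E (near_eq_derive _ hs).
  exact: derive_cst.
Unshelve. all: by end_near.
Qed.

(** Scalar integration by parts on the widened interval, where the boundary terms vanish; pairing
    with a fixed vector turns it into the weak derivative of an H-valued history. *)
Lemma test_function_parts (phi g dg : R -> R) : test_function mu phi ->
  (forall s : R, is_derive s 1 g (dg s)) -> continuous dg ->
  [/\ leb.-integrable I (fun s => (derive1 phi s * g s)%:E),
      leb.-integrable I (fun s => (phi s * dg s)%:E) &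
      \int[leb]_(s in I) (derive1 phi s * g s) = - \int[leb]_(s in I) (phi s * dg s)].
Proof.
move=> tphi gdg cdg.
have [a [b [ab abI [phi0 dphi0]]]] := test_function_support tphi.
have dcont (f : R -> R) : (forall s : R, derivable f s 1) -> continuous f.
  by move=> df s; apply: differentiable_continuous; apply/derivable1_diffP.
have dphi (s : R) : derivable phi s 1 by case: tphi => h _; exact: (h 0).
have cphi := dcont _ dphi.
have cdphi : continuous (derive1 phi).
  by apply: dcont => s; case: tphi => h _; exact: (h 1).
have cg : continuous g by apply: dcont => s; have [] := gdg s.
have key (k : R -> R) : continuous k -> (forall s, ~~ (a < s < b) -> k s = 0) ->
    leb.-integrable I (EFin \o k) /\
    \int[leb]_(s in I) k s = \int[leb]_(s in `[a, b]) k s.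
  move=> ck k0.
  have kE : k = k \_ `[a, b]%classic.
    apply/funext => s; rewrite patchE; case: ifPn => // /negP sab.
    apply: k0; apply/negP => /andP[/ltW as_ /ltW sb]; apply: sab.
    by apply/mem_set; rewrite /= in_itv /= as_.
  have IE : I `&` `[a, b]%classic = `[a, b]%classic by apply/setIidr.
  split.
    rewrite kE -restrict_EFin.
    apply/(@integrable_restrict _ _ _ leb `[a, b]%classic (measurable_itv _) I mI).
    rewrite IE; apply: continuous_compact_integrable; first exact: segment_compact.
    exact: continuous_subspaceT.
  by rewrite [in LHS]kE -Rintegral_mkcondr IE.
have [i1 e1] : leb.-integrable I (EFin \o (fun s => derive1 phi s * g s)) /\
    \int[leb]_(s in I) (derive1 phi s * g s) =
    \int[leb]_(s in `[a, b]) (derive1 phi s * g s).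
  apply: key; first by move=> s; apply: continuousM; [exact: cdphi|exact: cg].
  by move=> s /dphi0 ->; rewrite mul0r.
have [i2 e2] : leb.-integrable I (EFin \o (fun s => phi s * dg s)) /\
    \int[leb]_(s in I) (phi s * dg s) =
    \int[leb]_(s in `[a, b]) (phi s * dg s).
  apply: key; first by move=> s; apply: continuousM; [exact: cphi|exact: cdg].
  by move=> s /phi0 ->; rewrite mul0r.
split=> //; rewrite e1 e2.
rewrite (@Rintegration_by_parts _ phi g (derive1 phi) dg) //.
- rewrite !phi0 ?ltxx ?andbF // !mul0r subrr sub0r opprK.
  by [].
- exact: continuous_subspaceT.
- by apply: derivable_LRcontinuous; first exact: ltW.
- exact: continuous_subspaceT.
- by apply: derivable_LRcontinuous; [exact: ltW|move=> s _; have [] := gdg s].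
- by move=> s _; have [_ <-] := gdg s; rewrite derive1E.
Qed.

Lemma weak_derivative_scale (g dg : R -> R) (w : H) (f df : L2_fun H mu) :
  (forall s, f s = g s *: w) -> (forall s, df s = dg s *: w) ->
  (forall s : R, is_derive s 1 g (dg s)) -> continuous dg ->
  weak_derivative (\pi_M f) (\pi_M df).
Proof.
move=> fE dfE gdg cdg phi tphi.
have [i1 i2 e] := test_function_parts tphi gdg cdg.
have m (k : R -> R) : continuous k -> measurable_fun I k.
  by move=> ck; apply: measurable_funTS; exact: continuous_measurable_fun.
exists ((\int[leb]_(s in I) (derive1 phi s * g s)) *: w).
  apply: is_integral_repr.
    apply: m => s; apply: differentiable_continuous; apply/derivable1_diffP.
    by case: tphi => h _; exact: (h 1).
  by under eq_fun do rewrite fE; exact: is_integral_scale.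
rewrite e scaleNr opprK; apply: is_integral_repr.
  apply: m => s; apply: differentiable_continuous; apply/derivable1_diffP.
  by case: tphi => h _; exact: (h 0).
by under eq_fun do rewrite dfE; exact: is_integral_scale.
Qed.

Lemma vanishes_at_0_scale (g : R -> R) (w : H) (f : L2_fun H mu) :
  (forall s, f s = g s *: w) -> continuous g -> g 0 = 0 ->
  vanishes_at_0 (\pi_M f).
Proof.
move=> fE cg g0; exists f; split=> //.
  have -> : L2_val f = (fun s => g s *: w) by exact/funext.
  by move=> s _; apply: cvgZr_tmp; exact: cg.
have -> : L2_val f = (fun s => g s *: w) by exact/funext.
rewrite -(scale0r w); apply: cvgZr_tmp; rewrite -[in X in _ --> X]g0.
by apply: cvg_at_right_filter; exact: cg.
Qed.

End WeakDerivatives.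

(** * Quasimodes of the memory equation *)

Section SingleQuasimode.
Context (R : realType) (H : hilbertType R) (A B : operator H) (mu : memory_kernel R).
Local Notation leb := (@lebesgue_measure R).
Local Notation I := (history mu).
Local Notation M := (memory_space H mu).
Local Notation X := (phase_space B mu).
Local Notation N := (form_norm (@phase_dot R H mu B)).
Local Open Scope quotient_scope.

Let mI : measurable I := @measurable_history R mu.

Lemma memory_pi_eq0 (f : L2_fun H mu) : (forall s, f s = 0) -> \pi_M f = 0.
Proof.
move=> f0; have -> : f = 0 by apply: val_inj; apply/funext => s; exact: f0.
by [].
Qed.

Lemma phase_norm_velocity (v : H) : N ((0, v, 0) : X) = `|v|.
Proof.
rewrite /form_norm /phase_dot /= operator0 !dot_norm normr0 expr0n /= add0r.
have -> : memory_dot (0 : M) 0 = 0.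
  rewrite -(form_norm_sqr (memory_dot_semi_inner H mu)).
  by rewrite (form_norm0 (memory_dot_semi_inner H mu)) expr0n.
by rewrite addr0 sqrtr_sqr normr_id.
Qed.

Lemma phase_norm_velocity_le (x : X) : `|x.1.2| <= N x.
Proof.
rewrite -(ger0_norm (normr_ge0 x.1.2)) -sqrtr_sqr; apply: ler_wsqrtr.
rewrite /phase_dot !dot_norm addrAC lerDr addr_ge0 ?sqr_ge0 //.
by case: (memory_dot_semi_inner H mu).
Qed.

Variable la : R.
Local Notation c s := (cos (la * s)).
Local Notation t s := (sin (la * s)).

Let dcos (s : R) : is_derive s 1 (fun s : R => 1 - c s) (la * t s).
Proof.
apply: is_derive_eq; rewrite (_ : la%:A = la :> R); last exact: mulr1.
ring.
Qed.

Let dsin (s : R) : is_derive s 1 (fun s : R => t s) (la * c s).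
Proof.
apply: is_derive_eq; rewrite (_ : la%:A = la :> R); last exact: mulr1.
ring.
Qed.

Let cla : continuous (fun s : R => la * s).
Proof. by move=> s; apply: continuousM; [exact: cvg_cst | exact: cvg_id]. Qed.

Let csin : continuous (fun s : R => t s).
Proof. by move=> s; apply: continuous_comp; [exact: cla | exact: continuous_sin]. Qed.

Let ccos : continuous (fun s : R => c s).
Proof. by move=> s; apply: continuous_comp; [exact: cla | exact: continuous_cos]. Qed.

Let meas (g : R -> R) : continuous g -> measurable_fun setT g.
Proof. exact: continuous_measurable_fun. Qed.

Let L2_scale (g : R -> R) k (w : H) : continuous g -> (forall s, `|g s| <= k) ->
  exists f : L2_fun H mu, forall s, f s = g s *: w.
Proof.
move=> cg gk; have h := scale_L2 mu w (meas cg) gk.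
by exists (L2Fun h).
Qed.

Let mu_scale (g : R -> R) k (w : H) (f : L2_fun H mu) : continuous g ->
  (forall s, `|g s| <= k) -> (forall s, f s = g s *: w) ->
  is_integral I (fun s => mu s *: (repr (\pi_M f) : L2_fun H mu) s)
    ((\int[leb]_(s in I) (mu s * g s)) *: w).
Proof.
move=> cg gk fE; apply: is_integral_repr; first exact: kernel_measurable.
under eq_fun do rewrite fE; apply: is_integral_scale.
apply: (integrable_mul_bounded (c := k)) => //; first exact: kernel_integrable.
exact: measurable_funTS (meas cg).
Qed.

Lemma memory_quasimode (w : H) : is_sqrt A B -> dom A w -> 0 < la ->
  exists z f : complexification X,
  [/\ graph_shift (Complex 0 la) (complex_graph (@memory_generator R H A B mu)) z f,
      complex_norm N f <=
        `|A w - la ^+ 2 *: w + (\int[leb]_(s in I) (mu s * (1 - c s))) *: w| +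
        `|\int[leb]_(s in I) (mu s * t s)| * `|w| &
      la * `|w| <= complex_norm N z].
Proof.
move=> [_ _ AB _] Aw la0.
have Bw : w \in dom_pred B by apply/asboolP; exact: ((AB w).1 Aw).1.
pose u := DomType Bw.
have c1b s : `|1 - c s| <= 2.
  rewrite (le_trans (ler_normB _ _)) // normr1.
  by have := cos_max (la * s); lra.
have s1b s : `|t s| <= 1 by exact: sin_max.
have cc : continuous (fun s : R => 1 - c s).
  by move=> s; apply: cvgB; [exact: cvg_cst | exact: ccos].
have cdc : continuous (fun s : R => la * t s).
  by move=> s; apply: continuousM; [exact: cvg_cst | exact: csin].
have cds : continuous (fun s : R => la * c s).
  by move=> s; apply: continuousM; [exact: cvg_cst | exact: ccos].
have dcb s : `|la * t s| <= la by rewrite normrM gtr0_norm // ler_piMr ?(ltW la0) // sin_max.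
have dsb s : `|la * c s| <= la by rewrite normrM gtr0_norm // ler_piMr ?(ltW la0) // cos_max.
have [fc fcE] := L2_scale w cc c1b.
have [fs fsE] := L2_scale w csin s1b.
have [fdc fdcE] := L2_scale w cdc dcb.
have [fds fdsE] := L2_scale w cds dsb.
set a := \int[leb]_(s in I) (mu s * (1 - c s)).
set b := \int[leb]_(s in I) (mu s * t s).
(* Since 1 - e^{-i la s} = (1 - cos(la s)) + i sin(la s), the states z1 and z2 are the real and
   imaginary parts of (w, i la w, (1 - e^{-i la s}) w), and y1, y2 their images under the
   generator. *)
pose z1 : X := (u, 0, \pi_M fc).
pose z2 : X := (0, la *: w, \pi_M fs).
pose y1 : X := (0, - A w - a *: w, - \pi_M fdc + memory_cst mu 0).
pose y2 : X := (la *: u, - A 0 - b *: w, - \pi_M fds + memory_cst mu (la *: w)).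
have T1 : @memory_generator R H A B mu z1 y1.
  split => //=.
  - by exists (a *: w) => //; exact: mu_scale cc c1b fcE.
  - by exists (\pi_M fdc) => //; exact: weak_derivative_scale fcE fdcE dcos cdc.
  - by apply: vanishes_at_0_scale fcE cc _; rewrite mulr0 cos0 subrr.
have T2 : @memory_generator R H A B mu z2 y2.
  split => //=.
  - exact: dom0.
  - by exists (b *: w) => //; exact: mu_scale csin s1b fsE.
  - by exists (\pi_M fds) => //; exact: weak_derivative_scale fsE fdsE dsin cds.
  - by apply: vanishes_at_0_scale fsE csin _; rewrite mulr0 sin0.
pose r1 := A w - la ^+ 2 *: w + a *: w.
pose f1 : X := (0, r1, 0); pose f2 : X := (0, b *: w, 0).
pose cst_fun (v : H) : L2_fun H mu := L2Fun (cst_L2 mu v).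
(* [e13] and [e23] are the two parts of i la eta = - eta' + v, which holds exactly. *)
have e13 : memory_add (memory_opp (memory_scale la (\pi_M fs)))
    (memory_opp (memory_add (memory_opp (\pi_M fdc)) (\pi_M (cst_fun 0)))) = 0.
  rewrite memory_scaleE (memory_oppE (la *: fs)) (memory_oppE fdc) /reverse_coercion.
  rewrite (memory_addE (- fdc)) /reverse_coercion memory_oppE /reverse_coercion memory_addE.
  apply: memory_pi_eq0 => s.
  rewrite -[LHS]/(- (la *: fs s) - (- fdc s + 0)) fsE fdcE.
  by rewrite scalerA addr0 opprK addNr.
have e23 : memory_add (memory_scale la (\pi_M fc))
    (memory_opp (memory_add (memory_opp (\pi_M fds)) (\pi_M (cst_fun (la *: w))))) = 0.
  rewrite memory_scaleE (memory_oppE fds) /reverse_coercion.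
  rewrite (memory_addE (- fds)) /reverse_coercion memory_oppE /reverse_coercion memory_addE.
  apply: memory_pi_eq0 => s.
  rewrite -[LHS]/(la *: fc s - (- fds s + la *: w)) fcE fdsE.
  by rewrite scalerA mulrBr mulr1 scalerBl [X in X - _]addrC subrr.
have e1 : f1 = - (la *: z2) - y1.
  congr (_, _, _).
  - by rewrite /= scaler0 !oppr0 addr0.
  - rewrite /= scalerA -expr2 /r1 opprB opprK addrCA addrA.
    by rewrite [LHS]addrAC [RHS]addrC addrA.
  - exact: esym e13.
have e2 : f2 = la *: z1 - y2.
  congr (_, _, _).
  - by rewrite /= subrr.
  - by rewrite /= scaler0 operator0 oppr0 !sub0r opprK.
  - exact: esym e23.
exists (z1, z2), (f1, f2); split.
- exists (y1, y2) => //.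
  have -> : Complex 0 la *: ((z1, z2) : complexification X) =
    (0 *: z1 - la *: z2, 0 *: z2 + la *: z1) by [].
  by rewrite !scale0r sub0r add0r e1 e2.
- have := complex_norm_le (@phase_dot R H mu B) (f1, f2).
  by rewrite /= /f1 /f2 !phase_norm_velocity normrZ.
- rewrite -(@ler_pXn2r _ 2) ?nnegrE ?mulr_ge0 ?complex_norm_ge0 ?(ltW la0) //.
  rewrite complex_norm_sqr /= ler_wpDl ?sqr_ge0 //.
  rewrite lerXn2r ?nnegrE ?mulr_ge0 ?form_norm_ge0 ?(ltW la0) //.
  have := phase_norm_velocity_le z2.
  by rewrite /= normrZ gtr0_norm.
Qed.

End SingleQuasimode.

Section QuasimodeFamily.
Context (R : realType) (H : hilbertType R) (A B : operator H) (mu : memory_kernel R).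
Local Notation leb := (@lebesgue_measure R).
Local Notation I := (history mu).
Local Notation N := (form_norm (@phase_dot R H mu B)).

Lemma kernel_trig_bound (p l : R) : 0 <= p < 1 -> 0 < l ->
  s `^ p * mu s @[s --> 0^'+] --> l ->
  exists2 K, 0 < K & exists L, forall la : R, L <= la -> 0 < la ->
    `|\int[leb]_(s in I) (mu s * cos (la * s))| <= K * la `^ (p - 1) /\
    `|\int[leb]_(s in I) (mu s * sin (la * s))| <= K * la `^ (p - 1).
Proof.
move=> p01 l0 mul; have [K K0 [L hL]] := kernel_oscillation p01 l0 mul.
exists K => //; exists L => la Lla la0.
have shift (s : R) : la * (s + pi / la) = la * s + pi.
  by rewrite mulrDr mulrCA divff ?gt_eqF // mulr1.
have cla : continuous (fun s : R => la * s).
  by move=> s; apply: continuousM; [exact: cvg_cst | exact: cvg_id].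
split; apply: hL => //.
- apply: continuous_measurable_fun => s.
  by apply: continuous_comp; [exact: cla | exact: continuous_cos].
- by move=> s; exact: cos_max.
- by move=> s; rewrite shift cosDpi.
- apply: continuous_measurable_fun => s.
  by apply: continuous_comp; [exact: cla | exact: continuous_sin].
- by move=> s; exact: sin_max.
- by move=> s; rewrite shift sinDpi.
Qed.

Lemma memory_quasimodes (p l : R) : self_adjoint A ->
  (forall u, dom A u -> 0 <= dot (A u) u) -> unbounded A -> is_sqrt A B ->
  0 <= p < 1 -> 0 < l -> s `^ p * mu s @[s --> 0^'+] --> l ->
  exists2 kappa, 0 < kappa &
    quasimodes (@phase_dot R H mu B) (@memory_generator R H A B mu) kappa (2 - p).
Proof.
move=> saA Age0 ubA AB p01 l0 mul.
have [K K0 [L hL]] := kernel_trig_bound p01 l0 mul.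
have mI := @measurable_history R mu.
pose m0 := \int[leb]_(s in I) mu s.
have m00 : 0 <= m0 by apply: Rintegral_ge0 => s [s0 _]; exact: kernel_ge0.
(* One unit for the eigenvector error, and K each for the cosine and sine integrals. *)
pose K3 := 1 + 2 * K.
have K30 : 0 < K3 by rewrite /K3; lra.
exists K3^-1; first by rewrite invr_gt0.
move=> M0.
pose L1 := Num.max (Num.max M0 L) 1.
have L10 : 0 <= L1 by rewrite /L1 le_max ler01 orbT.
have [al Lal hal] := approximate_eigenvectors saA (L1 ^+ 2) ubA Age0.
(* In A v - la^2 v + (m0 - ic) v the total mass m0 cancels, leaving the eigenvector error and the
   cosine integral; al >= L1^2 gives la >= L1. *)
pose la := Num.sqrt (al + m0).
have alm : 0 <= al + m0 by rewrite addr_ge0 // (le_trans _ Lal) // sqr_ge0.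
have la2 : la ^+ 2 = al + m0 by rewrite sqr_sqrtr.
have Lla : L1 <= la.
  rewrite -(@ler_pXn2r _ 2) ?nnegrE ?sqrtr_ge0 // la2 (le_trans Lal) // lerDl //.
have : L1 <= la by []; rewrite {1}/L1 !ge_max => /andP[/andP[M0la Lla'] la1].
have la0 : 0 < la by lra.
have e0 : 0 < la `^ (p - 1) by rewrite powR_gt0.
have [w [Aw w0 hw]] := hal _ e0.
(* Makes the residual bound K3 la^{p-1} |v| equal to 1, while the velocity norm la |v| becomes
   la^{2-p} / K3; hence kappa = 1 / K3. *)
pose k := la `^ (1 - p) / K3 / `|w|.
have nw : 0 < `|w| by rewrite normr_gt0.
have k0 : 0 < k by rewrite !divr_gt0 ?powR_gt0.
pose v := k *: w.
have nv : `|v| = la `^ (1 - p) / K3 by rewrite normrZ gtr0_norm // /k divfK ?gt_eqF.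
have [Av Ev] := operatorZ k Aw.
have hv : `|A v - al *: v| <= la `^ (p - 1) * `|v|.
  have -> : A v - al *: v = k *: (A w - al *: w).
    by rewrite Ev scalerBr /v !scalerA (mulrC k).
  by rewrite !normrZ mulrCA ler_wpM2l.
have [z [f [Tzf fle zge]]] := memory_quasimode mu AB Av la0.
have [bc bs] := hL la Lla' la0.
exists la, z, f; split => //.
- apply: (le_trans fle).
  have -> : \int[leb]_(s in I) (mu s * (1 - cos (la * s))) =
      m0 - \int[leb]_(s in I) (mu s * cos (la * s)).
    rewrite -RintegralB //; first by apply: eq_Rintegral => s _; rewrite mulrBr mulr1.
      exact: kernel_integrable.
    apply: (integrable_mul_bounded (c := 1)) => //; first exact: kernel_integrable.
      apply: measurable_funTS; apply: continuous_measurable_fun => s.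
      apply: continuous_comp; last exact: continuous_cos.
      by apply: continuousM; [exact: cvg_cst | exact: cvg_id].
    by move=> s _; exact: cos_max.
  set ic := \int[leb]_(s in I) (mu s * cos (la * s)) in bc *.
  have -> : A v - la ^+ 2 *: v + (m0 - ic) *: v = (A v - al *: v) - ic *: v.
    by rewrite la2 scalerDl scalerBl opprD !addrA addrNK.
  apply: (@le_trans _ _ (K3 * la `^ (p - 1) * `|v|)).
    apply: (@le_trans _ _ (la `^ (p - 1) * `|v| + K * la `^ (p - 1) * `|v| +
                           K * la `^ (p - 1) * `|v|)).
      apply: lerD; last by rewrite ler_wpM2r.
      apply: (le_trans (ler_normB _ _)); apply: lerD => //.
      by rewrite normrZ ler_wpM2r.
    by rewrite /K3; lra.
  rewrite nv (mulrC K3) -mulrA (mulrCA K3) divff ?gt_eqF // mulr1 -powRD.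
    by rewrite subrKA subrr powRr0.
  by rewrite (gt_eqF la0) implybT.
- apply: le_trans zge; rewrite nv.
  have -> : la `^ (2 - p) = la * la `^ (1 - p).
    rewrite -{2}(powRr1 (ltW la0)) -powRD; last by rewrite (gt_eqF la0) implybT.
    by congr (_ `^ _); ring.
  by rewrite [leRHS]mulrA mulrC.
Qed.

End QuasimodeFamily.

Theorem theorem5 (R : realType) (H : hilbertType R) (A sqrtA : operator H)
    (mu : memory_kernel R) (delta p l : R) :
  separable H ->
  strictly_positive A -> unbounded A -> is_sqrt A sqrtA ->
  0 < delta ->
  {ae @lebesgue_measure R, forall s, 0 < s ->
    derivable mu s 1 /\ derive1 mu s + delta * mu s <= 0} ->
  0 <= p < 1 -> 0 < l ->
  s `^ p * mu s @[s --> 0^'+] --> l ->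
  (0 < limf_esup (fun la : R => (la `^ (p - 2))%:E *
         resolvent_norm (@phase_norm R H sqrtA mu)
           (@memory_generator R H A sqrtA mu) la) +oo%R)%E /\
  forall S : R -> phase_space sqrtA mu -> phase_space sqrtA mu,
    generates (@phase_norm R H sqrtA mu) (@memory_generator R H A sqrtA mu) S ->
    (0 < limf_esup (fun t : R => (t `^ (1 / (2 - p)))%:E *
           decay_norm (@phase_norm R H sqrtA mu)
             (@memory_generator R H A sqrtA mu) S t) +oo%R)%E.
Proof.
move=> _ [saA [c c0 Ac]] ubA AB _ _ p01 l0 mul.
have Age0 u : dom A u -> 0 <= dot (A u) u.
  by move=> /Ac; apply: le_trans; rewrite mulr_ge0 ?sqr_ge0 // ltW.
have [kappa k0 hq] := memory_quasimodes saA Age0 ubA AB p01 l0 mul.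
have q0 : 0 < 2 - p by case/andP : p01 => _ ?; lra.
rewrite phase_normE -[p - 2]opprB; split.
  exact: resolvent_limsup_gt0 k0 hq.
move=> S hS; apply: decay_limsup_gt0 k0 q0 hq hS.
exact: phase_dot_semi_inner.
Qed.
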